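(* Let $d$ be an odd integer and let $R$ be an evenly graded commutative ring in which $2$ is invertible. Let $|t|=-(d+2)$. Let $H$ be the group of formal power series $F(t)\in R[[t]]$ of degree $-(d+2)$ with vanishing constant term and with the coefficient of $t$ invertible in $R$, where the product of $(F,G)$ is $F(G(t))$. Let $H$ act on the right of the set $S$ of formal power series $u(t)\in R[[t]]$ of degree $-2$ with vanishing constant term, by $(u(t),f(t))\mapsto u(f(t))$. Then the set of unital weak equivalence classes of odd Moore algebras of degree $d$ over $R$ is in one-to-one correspondence with the set of orbits of $H$ acting on $S$.
   Context: Evenly graded means concentrated in even degrees. $R[[\tau,t]]$ denotes the graded $R$-algebra of formal power series in two non-commuting variables with $|\tau|=-1$, $|t|=-(d+2)$ (elements of $R$ are central), with its natural topology, and $R[[t]]$ is the algebra of power series in $t$ (when $d$ is odd, $t$ is odd but $t^2\neq 0$). A power series in $t$ has degree $n$ if every term $a_it^i$ has total degree $n$, i.e. $|a_i|=n+i(d+2)$. All derivations are graded derivations, $\xi(ab)=\xi(a)b+(-1)^{|\xi||a|}a\xi(b)$; $A\,\partial_\tau+B\,\partial_t$ denotes the continuous derivation with $\tau\mapsto A$, $t\mapsto B$; $ad\tau(x)=[\tau,x]$ is the graded commutator. A Moore algebra of degree $d$ is a unital $A_\infty$-structure on the free graded $R$-module $\Sigma^{d+1}R\oplus R$ with basis $1$ (degree $0$) and $y$ (degree $d+1$). For $d$ odd, such an (odd) Moore algebra is a continuous derivation of $R[[\tau,t]]$ of degree $-1$ of the form $$m=v(t)\partial_t+w(t)\partial_\tau+ad\tau-\tau^2\partial_\tau,\qquad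 v(t)=\sum_{i\ge1}v_it^{2i},\quad w(t)=\sum_{i\ge1}w_it^{2i},$$ where $v(t),w(t)\in R[[t]]$ have degrees $-(d+3)$ and $-2$ respectively (the condition $m^2=0$ is automatic). A unital $A_\infty$-isomorphism between the Moore algebras with structures $m$ and $m'$ is a continuous $R$-algebra automorphism $f$ of $R[[\tau,t]]$ of degree $0$ of the form $\tau\mapsto\tau+G(t)$, $t\mapsto F(t)$, where $G,F\in R[[t]]$ have vanishing constant terms, $G$ has degree $-1$, $F$ has degree $-(d+2)$, the coefficient of $t$ in $F$ is invertible, and $mf=fm'$. For odd Moore algebras the operation $m_1$ vanishes, so unital weak equivalences are the same as unital $A_\infty$-isomorphisms; unital weak equivalence classes are the equivalence classes for this relation. *)

(* Defs.v *)
From HB Require Import structures.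
From mathcomp Require Import all_boot all_order all_algebra.
From mathcomp Require Import boolp classical_sets functions.
From mathcomp Require Import zify.

Set Implicit Arguments.
Unset Strict Implicit.
Unset Printing Implicit Defensive.

Import GRing.Theory.

Local Open Scope classical_set_scope.
Local Open Scope ring_scope.

Record grading (R : pzRingType) := Grading {
  homog :> int -> set R;
  homog0 : forall n, homog n 0;
  homogB : forall n x y, homog n x -> homog n y -> homog n (x - y);
  homog1 : homog 0 1;
  homogM : forall m n x y, homog m x -> homog n y -> homog (m + n) (x * y);
  homog_sum : forall x, exists (s : seq int) (c : int -> R),
    (forall n, homog n (c n)) /\ x = \sum_(n <- s) c n;
  homog_free : forall (s : seq int) (c : int -> R), uniq s ->
    (forall n, homog n (c n)) -> \sum_(n <- s) c n = 0 ->
    forall n, n \in s -> c n = 0 }.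

Definition oddz (n : int) : bool := odd `|n|%N.

(* If R is evenly graded, graded commutative means commutative. *)
Definition evenly_graded (R : pzRingType) (gr : grading R) : Prop :=
  forall n x, oddz n -> gr n x -> x = 0.

Definition invertible (R : pzRingType) (x : R) : Prop :=
  exists y, x * y = 1 /\ y * x = 1.

(* R[[t]]: F n is the coefficient of t^n.  The variable t commutes with itself
   in the ungraded sense, so this is the usual commutative ring of power
   series, also when |t| is odd. *)
Definition psr (R : comPzRingType) : Type := nat -> R.

Section PowerSeriesRing.
Variable R : comPzRingType.
Implicit Types F G K : psr R.

HB.instance Definition _ := Choice.on (psr R).
HB.instance Definition _ := GRing.Lmodule.copy (psr R) (nat -> R^o).

Definition ps_one : psr R := fun n => (n == 0%N)%:R.
Definition ps_mul F G : psr R := fun n => \sum_(i < n.+1) F i * G (n - i)%N.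

Let mul0E F G : ps_mul F G 0%N = F 0%N * G 0%N.
Proof. by rewrite /ps_mul big_ord1. Qed.

Let mulSE F G n :
  ps_mul F G n.+1 = F 0%N * G n.+1 + ps_mul (F \o succn : psr R) G n.
Proof. by rewrite /ps_mul big_ord_recl; congr (_ + _); apply: eq_bigr. Qed.

Fact ps_mulC : commutative ps_mul.
Proof.
move=> F G; apply/funext => n; rewrite /ps_mul (reindex_inj rev_ord_inj) /=.
by apply: eq_bigr => i _; rewrite subSS subKn 1?mulrC // -ltnS.
Qed.

Fact ps_mulDl : left_distributive ps_mul +%R.
Proof.
move=> F G K; apply/funext => n; rewrite /ps_mul /= -[RHS]big_split /=.
by apply: eq_bigr => i _; rewrite mulrDl.
Qed.

Fact ps_mulA : associative ps_mul.
Proof.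
move=> F G K; apply/funext => n; elim: n F => [|n IHn] F.
  by rewrite !mul0E mulrA.
rewrite !mulSE mul0E IHn.
have -> : ps_mul F G \o succn
    = F 0%N *: (G \o succn : psr R) + ps_mul (F \o succn : psr R) G :> psr R.
  by apply/funext => k; rewrite /= mulSE.
rewrite ps_mulDl /= mulrDr mulrA -!addrA; congr (_ + _).
rewrite [RHS]/GRing.add /=; congr (_ + _).
by rewrite /ps_mul mulr_sumr; apply: eq_bigr => i _; rewrite mulrA.
Qed.

Fact ps_mul1 : left_id ps_one ps_mul.
Proof.
move=> F; apply/funext => n; rewrite /ps_mul big_ord_recl /= mul1r subn0.
by rewrite big1 ?addr0 // => i _; rewrite mul0r.
Qed.

HB.instance Definition _ := GRing.Zmodule_isComPzRing.Build (psr R)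
  ps_mulA ps_mulC ps_mul1 ps_mulDl.

(* F(G(t)) for G with vanishing constant term: then G ^+ i only contributes to
   the coefficients of t^n with i <= n. *)
Definition ps_comp F G : psr R := fun n => \sum_(i < n.+1) F i * (G ^+ i) n.

End PowerSeriesRing.

(* R[[tau,t]]: a w is the coefficient of the word w in the non-commuting
   variables tau (Ltau) and t (Lt).  Arbitrary coefficients are allowed; the
   graded pieces are singled out by nc_homog below. *)
Inductive letter := Ltau | Lt.

Definition ncpsr (R : comPzRingType) : Type := seq letter -> R.

Section NonCommutativePowerSeriesRing.
Variable R : comPzRingType.
Implicit Types a b c : ncpsr R.

HB.instance Definition _ := Choice.on (ncpsr R).
HB.instance Definition _ := GRing.Lmodule.copy (ncpsr R) (seq letter -> R^o).

Definition nc_one : ncpsr R := fun w => (nilp w)%:R.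
Definition nc_mul a b : ncpsr R :=
  fun w => \sum_(i < (size w).+1) a (take i w) * b (drop i w).

Let mul0E a b : nc_mul a b [::] = a [::] * b [::].
Proof. by rewrite /nc_mul big_ord1. Qed.

Let mulSE a b x w :
  nc_mul a b (x :: w) =
    a [::] * b (x :: w) + nc_mul (a \o cons x : ncpsr R) b w.
Proof. by rewrite /nc_mul big_ord_recl. Qed.

Fact nc_mulDl : left_distributive nc_mul +%R.
Proof.
move=> a b c; apply/funext => w; rewrite /nc_mul /= -[RHS]big_split /=.
by apply: eq_bigr => i _; rewrite mulrDl.
Qed.

Fact nc_mulDr : right_distributive nc_mul +%R.
Proof.
move=> a b c; apply/funext => w; rewrite /nc_mul /= -[RHS]big_split /=.
by apply: eq_bigr => i _; rewrite mulrDr.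
Qed.

Fact nc_mulA : associative nc_mul.
Proof.
move=> a b c; apply/funext => w; elim: w a => [|x w IHw] a.
  by rewrite !mul0E mulrA.
rewrite !mulSE mul0E IHw.
have -> : nc_mul a b \o cons x
    = a [::] *: (b \o cons x : ncpsr R) + nc_mul (a \o cons x : ncpsr R) b
    :> ncpsr R.
  by apply/funext => k; rewrite /= mulSE.
rewrite nc_mulDl /= mulrDr mulrA -!addrA; congr (_ + _).
rewrite [RHS]/GRing.add /=; congr (_ + _).
by rewrite /nc_mul mulr_sumr; apply: eq_bigr => i _; rewrite mulrA.
Qed.

Fact nc_mul1l : left_id nc_one nc_mul.
Proof.
move=> a; apply/funext => -[|x w]; first by rewrite mul0E mul1r.
by rewrite mulSE mul1r /nc_mul big1 ?addr0 // => i _; rewrite mul0r.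
Qed.

Fact nc_mul1r : right_id nc_one nc_mul.
Proof.
move=> a; apply/funext => w; elim: w a => [|x w IHw] a.
  by rewrite mul0E mulr1.
by rewrite mulSE IHw mulr0 add0r.
Qed.

HB.instance Definition _ := GRing.Zmodule_isPzRing.Build (ncpsr R)
  nc_mulA nc_mul1l nc_mul1r nc_mulDl nc_mulDr.

Definition vtau : ncpsr R := fun w => if w is [:: Ltau] then 1 else 0.
Definition vt : ncpsr R := fun w => if w is [:: Lt] then 1 else 0.

Definition is_Lt (x : letter) : bool := if x is Lt then true else false.

(* The inclusion of R[[t]] in R[[tau,t]]. *)
Definition ps_incl (F : psr R) : ncpsr R :=
  fun w => if all is_Lt w then F (size w) else 0.

(* Continuity for the (tau,t)-adic topology, that is the product topology on
   the coefficients with R discrete. *)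
Definition nc_continuous (f : ncpsr R -> ncpsr R) : Prop :=
  forall a N, exists M, forall b,
    (forall w, (size w < M)%N -> a w = b w) ->
    forall w, (size w < N)%N -> f a w = f b w.

End NonCommutativePowerSeriesRing.

Arguments vtau {R}.
Arguments vt {R}.

Section Degrees.
Variables (R : comPzRingType) (gr : grading R) (d : int).
Implicit Types (F G u v w : psr R) (a b : ncpsr R).
Implicit Types (xi m f : ncpsr R -> ncpsr R).

(* |tau| = -1 and |t| = -(d+2) *)
Definition letter_deg (x : letter) : int := if x is Ltau then -1 else - (d + 2).

Definition word_deg (s : seq letter) : int := \sum_(x <- s) letter_deg x.

Definition ps_homog (n : int) F : Prop := forall i, gr (n + (d + 2) *+ i) (F i).

Definition nc_homog (n : int) a : Prop := forall s, gr (n - word_deg s) (a s).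

Definition has_degree (k : int) xi : Prop :=
  forall n a, nc_homog n a -> nc_homog (n + k) (xi a).

Definition ksign (n : int) : R := (-1) ^+ `|n|%N.

(* The graded commutator, extended bilinearly to non-homogeneous series; for R
   evenly graded it agrees with the usual formula, see gcommE. *)
Definition gcomm a b : ncpsr R := fun s =>
  \sum_(i < (size s).+1)
    (a (take i s) * b (drop i s)
     - ksign (word_deg (take i s) * word_deg (drop i s))
       * (b (take i s) * a (drop i s))).

Definition ad a : ncpsr R -> ncpsr R := gcomm a.

Definition cont_derivation (k : int) xi : Prop :=
  [/\ linear xi, nc_continuous xi, has_degree k xi &
      forall n a b, nc_homog n a ->
        xi (a * b) = xi a * b + ksign (k * n) *: (a * xi b)].

(* xi is the continuous derivation A d_tau + B d_t, of degree k. *)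
Definition is_derivation_by (k : int) (A B : ncpsr R) xi : Prop :=
  [/\ cont_derivation k xi, xi vtau = A & xi vt = B].

Definition even_series v : Prop := v 0%N = 0 /\ forall i, odd i -> v i = 0.

Definition odd_Moore_algebra : set (ncpsr R -> ncpsr R) := [set m |
  cont_derivation (-1) m /\
  exists v w Dv Dw Dtau,
    [/\ even_series v /\ ps_homog (- (d + 3)) v,
        even_series w /\ ps_homog (-2) w,
        [/\ is_derivation_by (-1) 0 (ps_incl v) Dv,
            is_derivation_by (-1) (ps_incl w) 0 Dw &
            is_derivation_by (-1) (vtau ^+ 2) 0 Dtau] &
        forall a, m a = Dv a + Dw a + ad vtau a - Dtau a]].

Definition cont_automorphism f : Prop :=
  [/\ linear f, monoid_morphism f, bijective f & nc_continuous f].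

Definition changes_variable F : Prop :=
  [/\ F 0%N = 0, ps_homog (- (d + 2)) F & invertible (F 1%N)].

Definition unital_isomorphism m m' f : Prop :=
  [/\ cont_automorphism f, has_degree 0 f,
      exists F G,
        [/\ G 0%N = 0, ps_homog (-1) G, changes_variable F,
            f vtau = vtau + ps_incl G & f vt = ps_incl F] &
      m \o f = f \o m'].

Definition weakly_equivalent m m' : Prop := exists f, unital_isomorphism m m' f.

Definition weak_equivalence_class m : set (ncpsr R -> ncpsr R) :=
  [set m' | odd_Moore_algebra m' /\ weakly_equivalent m m'].

Definition weak_equivalence_classes : set (set (ncpsr R -> ncpsr R)) :=
  [set weak_equivalence_class m | m in odd_Moore_algebra].

(* The underlying set of the group H; its product is ps_comp. *)
Definition Hgroup : set (psr R) := [set F | changes_variable F].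

Definition Sset : set (psr R) := [set u | u 0%N = 0 /\ ps_homog (-2) u].

Definition H_orbit u : set (psr R) := [set ps_comp u F | F in Hgroup].

Definition H_orbits : set (set (psr R)) := [set H_orbit u | u in Sset].

Lemma gcommE (gr_even : evenly_graded gr) (n k : int) a b :
  nc_homog n a -> nc_homog k b -> gcomm a b = a * b - ksign (n * k) *: (b * a).
Proof.
move=> ha hb; apply/funext => s.
have -> : (a * b - ksign (n * k) *: (b * a)) s
  = nc_mul a b s - ksign (n * k) * nc_mul b a s by [].
rewrite /gcomm sumrB mulr_sumr; congr (_ - _); apply: eq_bigr => i _.
set p := take i s; set q := drop i s.
have oddB (x y : int) : oddz (x - y) = oddz x (+) oddz y.
  by rewrite /oddz; lia.
have ksignE (x y : int) : oddz x = oddz y -> ksign x = ksign y.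
  by rewrite /oddz /ksign => e; rewrite -signr_odd e signr_odd.
have [ep|/addbP ep] := boolP (oddz k (+) oddz (word_deg p)).
  by rewrite (gr_even (k - word_deg p) (b p)) ?oddB ?mul0r ?mulr0.
have [eq|/addbP eq] := boolP (oddz n (+) oddz (word_deg q)).
  by rewrite (gr_even (n - word_deg q) (a q)) ?oddB ?mulr0.
congr (_ * _); apply: ksignE; move: ep eq; rewrite /oddz !abszM !oddM.
by do 4!case: odd.
Qed.

End Degrees.

(* Main.v *)
Require Import Defs.
From mathcomp Require Import all_boot all_order all_algebra.
From mathcomp Require Import boolp classical_sets functions.
From mathcomp Require Import zify ring.

(** An odd Moore algebra m is given by two even series v and w, through
    m tau = w + tau^2 and m t = v + (tau t + t tau).  Let f be the automorphism
    tau |-> tau + G, t |-> F.  The maps m f and f m' obey the same twisted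
    Leibniz rule, so m f = f m' can be tested on tau and t.  Because R is evenly
    graded and tau, t have odd degree, F and G are odd series in t, and an odd
    series A satisfies m A = v A/t + (tau A + A tau), where A/t appears because
    t is an odd variable: the derivative of t^i is t^(i-1) for i odd and 0 for i
    even.  The terms with tau cancel ([intertwining_series]) and there remains

      v F/t = v'(F) + 2 G F    and    w + v G/t = w'(F) + G^2.

    Put V = v/t and V' = v'/t.  After division by F the first equation reads
    V = V'(F) + 2 G; as 2 is invertible, it has exactly one solution G, of the
    right degree, for every change of variable F.  Completing the square, the
    second equation becomes u = u'(F), where u = w + (V/2)^2 and
    u' = w' + (V'/2)^2 ([completing_square]).  Hence u is an element of S such
    that m and m' are equivalent iff some F in H carries u' to u
    ([weakly_equivalentP]), and every u in S is the invariant of the algebra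
    with v = 0 and w = u.  The bijection maps a weak equivalence class to the
    set of the invariants of its members, which is an orbit
    ([invariant_class]).

    Formal series are handled by one device.  Every series is a constant plus,
    for each variable x, x times a tail.  A map determined by its values on the
    variables therefore solves a recursion over tails in which each recursive
    term is multiplied by a series without constant term.  Such a recursion has
    a solution ([recursion_exists]), and it has only one because the difference
    of two solutions vanishes to every order ([nc_contraction],
    [ps_contraction]).  This yields the substitutions and derivations needed,
    their uniqueness, and the laws of composition; the same unfolding over tails
    gives inverses of series for multiplication and for composition. *)

Set Implicit Arguments.
Unset Strict Implicit.
Unset Printing Implicit Defensive.

Import GRing.Theory.

Local Open Scope ring_scope.

(** * Power series in t and their composition *)

Section PowerSeries.
Variable R : comPzRingType.
Implicit Types (A B F G : psr R) (c : R).

Definition ps_var : psr R := fun n => (n == 1%N)%:R.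

(** Division by t, the constant term being dropped. *)
Definition ps_tail A : psr R := fun n => A n.+1.

Lemma ps_addE A B n : (A + B) n = A n + B n. Proof. by []. Qed.
Lemma ps_oppE A n : (- A) n = - A n. Proof. by []. Qed.
Lemma ps_scaleE c A n : (c *: A) n = c * A n. Proof. by []. Qed.
Lemma ps_oneE n : (1 : psr R) n = (n == 0%N)%:R. Proof. by []. Qed.
Lemma ps_mulE A B n : (A * B) n = \sum_(i < n.+1) A i * B (n - i)%N.
Proof. by []. Qed.

Lemma ps_mul0E A B : (A * B) 0%N = A 0%N * B 0%N.
Proof. by rewrite ps_mulE big_ord1. Qed.

Lemma ps_scaleAl c A B : c *: (A * B) = c *: A * B.
Proof.
apply/funext => n; rewrite ps_scaleE !ps_mulE mulr_sumr.
by apply: eq_bigr => i _; rewrite mulrA.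
Qed.

Definition ps_const c : psr R := c *: (1 : psr R).

Lemma ps_scale_const c A : c *: A = ps_const c * A.
Proof. by rewrite /ps_const -ps_scaleAl mul1r. Qed.

Lemma ps_constM c e : ps_const (c * e) = ps_const c * ps_const e.
Proof. by rewrite -ps_scale_const /ps_const scalerA. Qed.

Lemma ps_constE c n : ps_const c n = if n is 0%N then c else 0.
Proof. by case: n => [|n]; rewrite /ps_const ps_scaleE ps_oneE ?mulr1 ?mulr0. Qed.

Lemma ps_mulVE A n : (ps_var * A) n = if n is k.+1 then A k else 0.
Proof.
case: n => [|n]; first by rewrite ps_mul0E /ps_var mul0r.
rewrite ps_mulE big_ord_recl big_ord_recl /ps_var /= mul0r add0r mul1r.
rewrite big1 ?addr0; first by rewrite /bump /= subSS subn0.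
by move=> i _; rewrite mul0r.
Qed.

Lemma ps_decomp A : A = ps_const (A 0%N) + ps_var * ps_tail A.
Proof.
apply/funext => -[|n]; rewrite ps_addE ps_constE ps_mulVE.
  by rewrite addr0.
by rewrite add0r.
Qed.

Lemma ps_decomp0 A : A 0%N = 0 -> A = ps_var * ps_tail A.
Proof. by move=> A0; rewrite {1}[A]ps_decomp A0 /ps_const scale0r add0r. Qed.

Lemma ps_mulV_inj : injective ( *%R ps_var).
Proof.
move=> A B /(congr1 ps_tail) E; apply/funext => n.
by move/(congr1 (fun C : psr R => C n)): E; rewrite /ps_tail !ps_mulVE.
Qed.

Lemma ps_tail_mul A B : ps_tail (A * B) = A 0%N *: ps_tail B + ps_tail A * B.
Proof.
apply/funext => n.
by rewrite /ps_tail ps_mulE big_ord_recl /= subn0.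
Qed.

(** If D x is a multiple of D (next x) by a series without constant term, then
    D x is divisible by every power of t. Used with D x the difference of the
    two sides of an identity. *)
Lemma ps_contraction (T : Type) (D : T -> psr R) (Y : psr R) (next : T -> T) :
  Y 0%N = 0 -> (forall x, D x = Y * D (next x)) -> forall x, D x = 0.
Proof.
move=> Y0 DE; suff D0 n : forall x k, (k < n)%N -> D x k = 0.
  by move=> x; apply/funext => k; exact: (D0 k.+1).
elim: n => // n IHn x k kn; rewrite DE ps_mulE big_ord_recl Y0 mul0r add0r.
rewrite big1 // => i _; rewrite [X in _ * X]IHn ?mulr0 //.
by have := ltn_ord i; rewrite lift0; lia.
Qed.

Lemma ps_pow_low F i n : F 0%N = 0 -> (n < i)%N -> (F ^+ i) n = 0.
Proof.
move=> F0; elim: i n => // i IHi n ni; rewrite exprS ps_mulE big_ord_recl.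
rewrite F0 mul0r add0r big1 // => j _; rewrite IHi ?mulr0 //.
by have := ltn_ord j; rewrite lift0; lia.
Qed.

Lemma ps_comp_widen A F n N : F 0%N = 0 -> (n < N)%N ->
  ps_comp A F n = \sum_(i < N) A i * (F ^+ i) n.
Proof.
move=> F0 nN; rewrite /ps_comp (big_ord_widen N (fun i => A i * (F ^+ i) n)) //.
rewrite big_mkcond /=; apply: eq_bigr => i _; case: ltnP => // ni.
by rewrite ps_pow_low ?mulr0.
Qed.

(** The Horner form of composition, from which every law of composition follows
    by [ps_contraction]. *)
Lemma ps_compE A F : F 0%N = 0 ->
  ps_comp A F = ps_const (A 0%N) + F * ps_comp (ps_tail A) F.
Proof.
move=> F0; apply/funext => n; rewrite ps_addE /ps_const ps_scaleE.
rewrite (@ps_comp_widen A F n n.+2) // big_ord_recl expr0; congr (_ + _).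
rewrite ps_mulE; under [RHS]eq_bigr => j _.
  rewrite (@ps_comp_widen _ _ (n - j) n.+1) ?ltnS ?leq_subr // mulr_sumr.
  over.
rewrite exchange_big; apply: eq_bigr => i _.
by rewrite lift0 exprS ps_mulE mulr_sumr; apply: eq_bigr => j _; rewrite mulrCA.
Qed.

Lemma ps_comp0E A F : ps_comp A F 0%N = A 0%N.
Proof. by rewrite /ps_comp big_ord1 expr0 ps_oneE mulr1. Qed.

Lemma ps_compD A B F : ps_comp (A + B) F = ps_comp A F + ps_comp B F.
Proof.
apply/funext => n; rewrite ps_addE /ps_comp -big_split /=.
by apply: eq_bigr => i _; rewrite ps_addE mulrDl.
Qed.

Lemma ps_compZ c A F : ps_comp (c *: A) F = c *: ps_comp A F.
Proof.
apply/funext => n; rewrite ps_scaleE /ps_comp mulr_sumr.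
by apply: eq_bigr => i _; rewrite ps_scaleE mulrA.
Qed.

Lemma ps_compN A F : ps_comp (- A) F = - ps_comp A F.
Proof. by rewrite -scaleN1r ps_compZ scaleN1r. Qed.

Lemma ps_comp1 F : ps_comp 1 F = 1.
Proof.
apply/funext => n; rewrite /ps_comp big_ord_recl expr0 ps_oneE mul1r big1.
  by rewrite addr0.
by move=> i _; rewrite ps_oneE mul0r.
Qed.

Lemma ps_comp_const c F : ps_comp (ps_const c) F = ps_const c.
Proof. by rewrite ps_compZ ps_comp1. Qed.

Lemma ps_compX F : F 0%N = 0 -> ps_comp ps_var F = F.
Proof.
move=> F0; rewrite ps_compE // /ps_const scale0r add0r.
have -> : ps_tail ps_var = 1 by [].
by rewrite ps_comp1 mulr1.
Qed.

Lemma ps_comp_id A : ps_comp A ps_var = A.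
Proof.
apply/eqP; rewrite -subr_eq0; apply/eqP.
pose D A := ps_comp A ps_var - A.
apply: (@ps_contraction _ D ps_var ps_tail) => // {}A; rewrite /D.
by rewrite ps_compE // {3}[A]ps_decomp; ring.
Qed.

Lemma ps_compM A B F : F 0%N = 0 ->
  ps_comp (A * B) F = ps_comp A F * ps_comp B F.
Proof.
move=> F0; apply/eqP; rewrite -subr_eq0; apply/eqP.
pose D A := ps_comp (A * B) F - ps_comp A F * ps_comp B F.
apply: (@ps_contraction _ D F ps_tail) => // {}A; rewrite /D.
rewrite (ps_compE (A * B)) // (ps_compE A) // ps_tail_mul ps_compD ps_compZ.
rewrite ps_mul0E ps_constM ps_scale_const (ps_compE B F0); ring.
Qed.

Lemma ps_compA A G F : G 0%N = 0 -> F 0%N = 0 ->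
  ps_comp (ps_comp A G) F = ps_comp A (ps_comp G F).
Proof.
move=> G0 F0; have GF0 : ps_comp G F 0%N = 0 by rewrite ps_comp0E.
apply/eqP; rewrite -subr_eq0; apply/eqP.
pose D A := ps_comp (ps_comp A G) F - ps_comp A (ps_comp G F).
apply: (@ps_contraction _ D (ps_comp G F) ps_tail) => // {}A; rewrite /D.
rewrite (ps_compE A G0) (ps_compE A GF0) ps_compD ps_comp_const ps_compM //.
ring.
Qed.

(** The quotient of a long division whose successive dividends are A, step A,
    step (step A), and so on: each coefficient is the constant term of a
    dividend. Both inverses below are divisions of this kind. *)
Definition ps_unfold (step : psr R -> psr R) A : psr R :=
  fun n => iter n step A 0%N.

Lemma ps_tail_unfold step A : ps_tail (ps_unfold step A) = ps_unfold step (step A).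
Proof. by apply/funext => n; rewrite /ps_tail /ps_unfold iterSr. Qed.

(** The division algorithm: A - (A_0/U_0) U has no constant term, so that it is
    t times the next dividend. *)
Definition ps_inv_step (U : psr R) (c : R) A := ps_tail (A - c * A 0%N *: U).
Definition ps_inv (U : psr R) (c : R) : psr R :=
  c *: ps_unfold (ps_inv_step U c) 1.

Lemma ps_invP U c : c * U 0%N = 1 -> ps_inv U c * U = 1.
Proof.
move=> cU; pose D A := c *: ps_unfold (ps_inv_step U c) A * U - A.
suff /eqP : D 1 = 0 by rewrite /D subr_eq0 => /eqP.
apply: (@ps_contraction _ D ps_var (ps_inv_step U c)) => // A; rewrite /D.
set st := ps_inv_step U c; set V := ps_unfold st.
rewrite [V A]ps_decomp ps_tail_unfold -/V !ps_scale_const mulrBr.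
have -> : ps_var * st A = A - ps_const (c * A 0%N) * U.
  rewrite -ps_scale_const -ps_decomp0 // ps_addE ps_oppE ps_scaleE.
  by rewrite mulrAC cU mul1r subrr.
rewrite [V A 0%N]/V /ps_unfold /= ps_constM; ring.
Qed.
End PowerSeries.

(** * The group of changes of variable *)

Section Grading.
Variables (R : comPzRingType) (gr : grading R).

Lemma homogN n x : gr n x -> gr n (- x).
Proof. by move=> hx; rewrite -sub0r; apply: homogB => //; exact: homog0. Qed.

Lemma homogD n x y : gr n x -> gr n y -> gr n (x + y).
Proof. by move=> hx hy; rewrite -[y]opprK; apply: homogB => //; exact: homogN. Qed.

Lemma homog_bigsum n (I : Type) (r : seq I) (P : pred I) (f : I -> R) :
  (forall i, P i -> gr n (f i)) -> gr n (\sum_(i <- r | P i) f i).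
Proof.
by move=> hf; elim/big_ind: _ => //; [exact: homog0|exact: homogD].
Qed.

(** The component of degree 0 of an inverse of x is already an inverse of x,
    hence equal to it. *)
Lemma homog_inv x y : gr 0 x -> x * y = 1 -> gr 0 y.
Proof.
move=> hx xy; have [s0 [c0 [hc0 yE0]]] := homog_sum gr y.
pose s := undup (0 :: s0); pose c n := c0 n *+ count_mem n s0.
have hc n : gr n (c n).
  rewrite /c; elim: (count_mem n s0) => [|k IHk]; first exact: homog0.
  by rewrite mulrS; apply: homogD.
have yE : y = \sum_(n <- s) c n.
  rewrite yE0 -big_undup_iterop_count /=.
  rewrite (eq_bigr c) => [|n _]; last by rewrite Monoid.iteropE iter_addr_0.
  rewrite /s /=; case: ifP => // /negbT s00.
  by rewrite big_cons (_ : c 0 = 0) ?add0r // /c (count_memPn s00).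
have us : uniq s by exact: undup_uniq.
have s0' : 0 \in s by rewrite mem_undup mem_head.
pose e n := x * c n - (n == 0)%:R.
have he n : gr n (e n).
  apply: homogB; first by rewrite -[n in gr n _]add0r; apply: homogM.
  by case: eqVneq => [->|_]; [exact: homog1|exact: homog0].
have e0 : \sum_(n <- s) e n = 0.
  rewrite sumrB -mulr_sumr -yE xy (bigD1_seq 0) //= big1 ?addr0 ?subrr //.
  by move=> n /negPf ->.
have c_eq0 n : n \in s -> n != 0 -> c n = 0.
  move=> ns n0; have := homog_free us he e0 ns.
  rewrite /e (negPf n0) subr0 => xc.
  by rewrite -[c n]mul1r -xy mulrAC xc mul0r.
rewrite yE (bigD1_seq 0) //= big_seq_cond big1 ?addr0 //.
by move=> n /andP[]; exact: c_eq0.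
Qed.

End Grading.

Section HomogeneousPowerSeries.
Variables (R : comPzRingType) (gr : grading R) (d : int).
Implicit Types (A B F G : psr R) (n k : int).
Local Notation ps_homog := (ps_homog gr d).

Lemma ps_homogD n A B : ps_homog n A -> ps_homog n B -> ps_homog n (A + B).
Proof. by move=> hA hB i; apply: homogD. Qed.

Lemma ps_homogN n A : ps_homog n A -> ps_homog n (- A).
Proof. by move=> hA i; apply: homogN. Qed.

Lemma ps_homogZ n c A : gr 0 c -> ps_homog n A -> ps_homog n (c *: A).
Proof. by move=> hc hA i; rewrite -[n]add0r -addrA; apply: homogM. Qed.

Lemma ps_homog1 : ps_homog 0 (1 : psr R).
Proof.
move=> [|i]; rewrite ps_oneE; last exact: homog0.
by rewrite mulr0n addr0; exact: homog1.
Qed.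

Lemma ps_homogM n k A B :
  ps_homog n A -> ps_homog k B -> ps_homog (n + k) (A * B).
Proof.
move=> hA hB i; rewrite ps_mulE; apply: homog_bigsum => j _.
have -> : n + k + (d + 2) *+ i = (n + (d + 2) *+ j) + (k + (d + 2) *+ (i - j)).
  by rewrite addrACA -mulrnDr subnKC // -ltnS.
exact: homogM.
Qed.

Lemma ps_homog_tail n A : ps_homog n A -> ps_homog (n + (d + 2)) (ps_tail A).
Proof. by move=> hA i; rewrite -addrA -mulrS; exact: hA. Qed.

Lemma ps_homog_var : ps_homog (- (d + 2)) (ps_var R).
Proof.
move=> [|[|i]]; rewrite /ps_var /=; try exact: homog0.
by rewrite mulr1n addNr; exact: homog1.
Qed.

Lemma ps_homog_comp n A F :
  ps_homog n A -> ps_homog (- (d + 2)) F -> ps_homog n (ps_comp A F).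
Proof.
move=> hA hF k; apply: homog_bigsum => i _.
have -> : n + (d + 2) *+ k
    = (n + (d + 2) *+ i) + ((- (d + 2)) *+ i + (d + 2) *+ k).
  by rewrite mulNrn; ring.
apply: homogM => //.
suff : ps_homog (- (d + 2) *+ i) (F ^+ i) by [].
elim: (nat_of_ord i) => [|j IHj]; first by rewrite mulr0n; exact: ps_homog1.
by rewrite exprS mulrS; apply: ps_homogM.
Qed.

Lemma ps_homog_unfold n step A :
  (forall m B, ps_homog m B -> ps_homog (m + (d + 2)) (step B)) ->
  ps_homog n A -> ps_homog n (ps_unfold step A).
Proof.
move=> hs hA i; rewrite /ps_unfold -[n + _]addr0 -(mulr0n (d + 2)).
suff: ps_homog (n + (d + 2) *+ i) (iter i step A) by [].
elim: i => [|i IHi]; first by rewrite mulr0n addr0.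
by rewrite iterS mulrSr addrA; apply: hs.
Qed.

Lemma ps_homog_inv U c : gr 0 c -> ps_homog 0 U -> ps_homog 0 (ps_inv U c).
Proof.
move=> hc hU; apply: ps_homogZ => //; apply: ps_homog_unfold; last exact: ps_homog1.
move=> m B hB; apply: ps_homog_tail; apply: ps_homogD => //; apply: ps_homogN.
move=> i; rewrite ps_scaleE -mulrA -[m]add0r -addrA; apply: homogM => //.
have -> : m + (d + 2) *+ i = (m + (d + 2) *+ 0) + (0 + (d + 2) *+ i).
  by rewrite mulr0n addr0 add0r.
exact: homogM.
Qed.

(** F is t times a unit V^-1 of degree 0; this gives sense to division by
    F. *)
Lemma changes_variable_tail_inv F : changes_variable gr d F ->
  exists2 V, ps_homog 0 V & V * ps_tail F = 1.
Proof.
move=> [F0 hF [c [F1c cF1]]]; have hU : ps_homog 0 (ps_tail F).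
  by rewrite -(addNr (d + 2)); exact: ps_homog_tail.
have hc : gr 0 c.
  apply: (homog_inv _ F1c); rewrite -[0](addNr (d + 2)).
  by rewrite -[in X in _ + X](mulr1n (d + 2)); exact: hF.
by exists (ps_inv (ps_tail F) c); [exact: ps_homog_inv|exact: ps_invP].
Qed.

(** An L with L(F) = A has constant term A_0, and its tail L' satisfies L'(F) =
    V A' where A' is the tail of A and t = V F. Unfolding this for A = t
    produces the inverse of F. *)
Lemma changes_variable_left_inv F : changes_variable gr d F ->
  exists2 L, changes_variable gr d L & ps_comp L F = ps_var R.
Proof.
move=> FH; have [F0 hF [c [F1c cF1]]] := FH.
have [V hV VU] := changes_variable_tail_inv FH.
pose st A := V * ps_tail A; pose L := ps_unfold st (ps_var R).
have LF : ps_comp L F = ps_var R.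
  (* F * V = t, so F * st A = A - A_0, which is the Horner form of L(F) = A. *)
  pose D A := ps_comp (ps_unfold st A) F - A.
  suff /eqP : D (ps_var R) = 0 by rewrite subr_eq0 => /eqP.
  apply: (@ps_contraction _ _ D F st) => // A; rewrite /D.
  set W := ps_comp (ps_unfold st (st A)) F.
  have -> : ps_comp (ps_unfold st A) F = ps_const (A 0%N) + F * W.
    by rewrite (ps_compE _ F0) ps_tail_unfold.
  have FV : F * V = ps_var R by rewrite [F](ps_decomp0 F0) mulrAC -mulrA VU mulr1.
  have FstA : F * st A = ps_var R * ps_tail A by rewrite /st mulrA FV.
  by rewrite mulrBr FstA {2}[A]ps_decomp; ring.
exists L => //; split; first by [].
  apply: ps_homog_unfold; last exact: ps_homog_var.
  move=> m A hA; rewrite -[m + _]add0r; apply: ps_homogM => //.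
  exact: ps_homog_tail.
have L1F1 : L 1%N * F 1%N = 1.
  move/(congr1 (fun A : psr R => A 1%N)): LF.
  by rewrite /ps_comp big_ord_recl big_ord1 mul0r add0r expr1.
by exists (F 1%N); rewrite L1F1 mulrC L1F1.
Qed.

(** In a monoid where every element has a left inverse, left inverses are
    inverses. *)
Lemma changes_variable_inv F : changes_variable gr d F ->
  exists2 L, changes_variable gr d L &
    ps_comp L F = ps_var R /\ ps_comp F L = ps_var R.
Proof.
move=> FH; have [L LH LF] := changes_variable_left_inv FH.
have [K KH KL] := changes_variable_left_inv LH.
have [F0 _ _] := FH; have [L0 _ _] := LH; have [K0 _ _] := KH.
exists L => //; split => //; suff -> : F = K by [].
by rewrite -[K]ps_comp_id // -LF -ps_compA // KL ps_compX.
Qed.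

End HomogeneousPowerSeries.

(** * Power series in two non-commuting variables *)

Section PointwiseFormulas.
Variable R : comPzRingType.
Implicit Types (a b : ncpsr R) (c : R) (s : seq letter).

Lemma nc_addE a b s : (a + b) s = a s + b s. Proof. by []. Qed.
Lemma nc_oppE a s : (- a) s = - a s. Proof. by []. Qed.
Lemma nc_scaleE c a s : (c *: a) s = c * a s. Proof. by []. Qed.
Lemma nc_zeroE s : (0 : ncpsr R) s = 0. Proof. by []. Qed.
Lemma nc_mulE a b s :
  (a * b) s = \sum_(i < (size s).+1) a (take i s) * b (drop i s).
Proof. by []. Qed.

End PointwiseFormulas.

(** Equalities between sums of products are settled coefficient by coefficient,
    where they become identities of the commutative ring R with the coefficients
    of the non-commutative products as atoms. *)
Ltac nc_abel :=
  apply/funext => ?; rewrite ?(nc_addE, nc_oppE, nc_scaleE, nc_zeroE); ring.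

Section NoncommutativePowerSeries.
Variable R : comPzRingType.
Implicit Types (a b X Y : ncpsr R) (A B F G : psr R) (c : R) (x y : letter).
Implicit Types (s p : seq letter).

Definition letter_var x : ncpsr R := if x is Ltau then vtau else vt.
Definition nc_tail x a : ncpsr R := fun s => a (x :: s).

Lemma nc_mul0E a b : (a * b) [::] = a [::] * b [::].
Proof. by rewrite nc_mulE big_ord1. Qed.

Lemma nc_scaleAl c a b : c *: (a * b) = c *: a * b.
Proof.
apply/funext => s; rewrite nc_scaleE !nc_mulE mulr_sumr.
by apply: eq_bigr => i _; rewrite mulrA.
Qed.

Lemma nc_scaleAr c a b : c *: (a * b) = a * (c *: b).
Proof.
apply/funext => s; rewrite nc_scaleE !nc_mulE mulr_sumr.
by apply: eq_bigr => i _; rewrite mulrCA.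
Qed.

Lemma nc_scale1l c a : c *: (1 : ncpsr R) * a = c *: a.
Proof. by rewrite -nc_scaleAl mul1r. Qed.

Lemma nc_scale1r c a : a * (c *: (1 : ncpsr R)) = c *: a.
Proof. by rewrite -nc_scaleAr mulr1. Qed.

Lemma nc_ext a b :
  a [::] = b [::] -> (forall x, nc_tail x a = nc_tail x b) -> a = b.
Proof.
move=> ab0 abS; apply/funext => -[//|x s].
by move/(congr1 (fun e : ncpsr R => e s)): (abS x).
Qed.

Lemma nc_tailD x a b : nc_tail x (a + b) = nc_tail x a + nc_tail x b.
Proof. by []. Qed.

Lemma nc_tailZ x c a : nc_tail x (c *: a) = c *: nc_tail x a.
Proof. by []. Qed.

Lemma nc_tail1 x : nc_tail x 1 = 0.
Proof. by []. Qed.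

Lemma nc_tailM x a b :
  nc_tail x (a * b) = a [::] *: nc_tail x b + nc_tail x a * b.
Proof. by apply/funext => s; rewrite /nc_tail nc_mulE big_ord_recl. Qed.

Lemma letter_var0 x : letter_var x [::] = 0.
Proof. by case: x. Qed.

Lemma nc_tail_letter x y :
  nc_tail y (letter_var x) = if is_Lt x == is_Lt y then 1 else 0.
Proof. by case: x y => [] [] /=; apply/funext => -[|z s]. Qed.

Lemma nc_decomp a :
  a = a [::] *: (1 : ncpsr R) + vtau * nc_tail Ltau a + vt * nc_tail Lt a.
Proof.
apply: nc_ext => [|x].
  rewrite !nc_addE !nc_mul0E nc_scaleE !mul0r !addr0; exact/esym/mulr1.
rewrite !nc_tailD nc_tailZ nc_tail1 scaler0 add0r !nc_tailM.
rewrite -![_ [::] *: _]/(0 *: _) !scale0r !add0r.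
rewrite -[vtau]/(letter_var Ltau) -[vt]/(letter_var Lt) !nc_tail_letter.
by case: x; rewrite /= mul1r mul0r ?addr0 ?add0r.
Qed.

(** A factor without constant term shields the longest words: this is what
    makes recursions over tails well founded. *)
Lemma nc_mul_low Y a b s : Y [::] = 0 ->
  (forall p, (size p < size s)%N -> a p = b p) -> (Y * a) s = (Y * b) s.
Proof.
move=> Y0 ab; rewrite !nc_mulE !big_ord_recl take0 Y0 !mul0r; congr (_ + _).
apply: eq_bigr => i _; congr (_ * _); apply: ab.
by rewrite size_drop lift0; have := ltn_ord i; lia.
Qed.

(** The analogue of [ps_contraction]: D z vanishes to every order, each Y x
    being without constant term. *)
Lemma nc_contraction (T : Type) (D : T -> ncpsr R) (Y : letter -> ncpsr R)
    (next : letter -> T -> T) :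
    (forall x, Y x [::] = 0) ->
    (forall z, D z = Y Ltau * D (next Ltau z) + Y Lt * D (next Lt z)) ->
  forall z, D z = 0.
Proof.
move=> Y0 DE; suff D0 n : forall z s, (size s < n)%N -> D z s = 0.
  by move=> z; apply/funext => s; exact: (D0 (size s).+1).
elim: n => // n IHn z s sn; rewrite DE nc_addE.
rewrite !(@nc_mul_low (Y _) (D _) 0) ?mulr0 ?addr0 // => p ps;
  by apply: IHn; lia.
Qed.

Lemma ps_inclD A B : ps_incl (A + B) = ps_incl A + ps_incl B.
Proof.
by apply/funext => s; rewrite nc_addE /ps_incl; case: ifP => //; rewrite addr0.
Qed.

Lemma ps_inclZ c A : ps_incl (c *: A) = c *: ps_incl A.
Proof.
by apply/funext => s; rewrite nc_scaleE /ps_incl; case: ifP => //; rewrite mulr0.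
Qed.

Lemma ps_inclN A : ps_incl (- A) = - ps_incl A.
Proof. by rewrite -scaleN1r ps_inclZ scaleN1r. Qed.

Lemma ps_incl1 : ps_incl (1 : psr R) = 1.
Proof. by apply/funext => -[|[] s] //=; rewrite /ps_incl //=; case: ifP. Qed.

Lemma ps_incl_tail A : nc_tail Lt (ps_incl A) = ps_incl (ps_tail A).
Proof. by []. Qed.

Lemma ps_incl_tau A : nc_tail Ltau (ps_incl A) = 0.
Proof. by []. Qed.

Lemma ps_incl_decomp A :
  ps_incl A = A 0%N *: (1 : ncpsr R) + vt * ps_incl (ps_tail A).
Proof. by rewrite {1}[ps_incl A]nc_decomp ps_incl_tau mulr0 addr0. Qed.

Lemma ps_inclM A B : ps_incl (A * B) = ps_incl A * ps_incl B.
Proof.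
apply/eqP; rewrite -subr_eq0; apply/eqP.
pose D A := ps_incl (A * B) - ps_incl A * ps_incl B.
apply: (@nc_contraction _ D (fun x => if x is Lt then vt else 0)
  (fun=> @ps_tail R)) => [[]//|{}A]; rewrite /D mul0r add0r.
rewrite ps_incl_decomp (ps_incl_decomp A) ps_tail_mul ps_inclD ps_inclZ.
rewrite ps_mul0E mulrDl nc_scale1l [in X in _ - (_ *: X + _)]ps_incl_decomp.
rewrite scalerDr scalerA mulrDr -nc_scaleAr mulrBr mulrA; nc_abel.
Qed.

Lemma ps_incl_var : ps_incl (ps_var R) = vt.
Proof. by apply/funext => -[|[] [|[] s]] //; rewrite /ps_incl /=; case: ifP. Qed.

Lemma ps_incl_inj : injective (@ps_incl R).
Proof.
move=> A B /(congr1 (fun a : ncpsr R => fun n => a (nseq n Lt))) AB.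
apply/funext => n; move/(congr1 (fun f : nat -> R => f n)): AB.
by rewrite /ps_incl all_nseq orbT size_nseq.
Qed.

Section LinearMaps.
Variable f : ncpsr R -> ncpsr R.
Hypothesis f_lin : linear f.

Lemma linear_add a b : f (a + b) = f a + f b.
Proof. by have := f_lin 1 a b; rewrite !scale1r. Qed.

Lemma linear_zero : f 0 = 0.
Proof. by apply: (@addIr _ (f 0)); rewrite -linear_add !addr0 add0r. Qed.

Lemma linear_scale c a : f (c *: a) = c *: f a.
Proof. by have := f_lin c a 0; rewrite linear_zero !addr0. Qed.

End LinearMaps.

Section Recursion.
Variables (base : ncpsr R -> ncpsr R) (Y : letter -> ncpsr R).
Hypothesis Y0 : forall x, Y x [::] = 0.

Definition solves_recursion (g : ncpsr R -> ncpsr R) := forall a,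
  g a = base a + Y Ltau * g (nc_tail Ltau a) + Y Lt * g (nc_tail Lt a).

(** The coefficient of a word s is the same in all iterates of the recursion
    from the (|s| + 1)-st on, so the iterates converge. *)
Lemma recursion_exists : {g | solves_recursion g}.
Proof.
pose step (g : ncpsr R -> ncpsr R) a : ncpsr R :=
  base a + Y Ltau * g (nc_tail Ltau a) + Y Lt * g (nc_tail Lt a).
pose approx n := iter n step (fun=> 0).
have stable m n a s : (size s < m)%N -> (size s < n)%N ->
    approx m a s = approx n a s.
  elim: m n a s => // m IHm [//|n] a s sm sn.
  rewrite /approx !iterS -/(approx m) -/(approx n) /step !nc_addE.
  by congr (_ + _ + _); apply: nc_mul_low => // p ps; apply: IHm; lia.
exists (fun a s => approx (size s).+1 a s) => a; apply/funext => s.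
rewrite {1}/approx iterS -/(approx _) {1}/step !nc_addE.
by congr (_ + _ + _); apply: nc_mul_low => // p ps; apply: stable.
Qed.

Variable g : ncpsr R -> ncpsr R.
Hypothesis gE : solves_recursion g.

(** By uniqueness: the failure of linearity solves the homogeneous
    recursion. *)
Lemma recursion_linear : linear base -> linear g.
Proof.
move=> base_lin c a b; apply/eqP; rewrite -subr_eq0; apply/eqP.
pose D z := g (c *: z.1 + z.2) - (c *: g z.1 + g z.2).
apply: (@nc_contraction _ D Y (fun x z => (nc_tail x z.1, nc_tail x z.2)) Y0 _
  (a, b)) => {a b} -[a b]; rewrite /D /=.
rewrite (gE (_ + _)) (gE a) (gE b) !nc_tailD !nc_tailZ base_lin.
by rewrite !mulrBr !mulrDr -!nc_scaleAr; nc_abel.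
Qed.

Lemma recursion_continuous :
    (forall a b N, (forall s, (size s < N.+1)%N -> a s = b s) ->
      forall s, (size s < N)%N -> base a s = base b s) ->
  nc_continuous g.
Proof.
move=> base_cont a N; exists N.+1; elim: N a => // N IHN a b ab s sN.
rewrite (gE a) (gE b) !nc_addE (base_cont a b N.+1) //.
congr (_ + _ + _); apply: nc_mul_low => // p ps.
  by apply: (IHN) => [q qN|]; [exact: ab|lia].
by apply: (IHN) => [q qN|]; [exact: ab|lia].
Qed.

End Recursion.

Section Substitution.
Variable X : letter -> ncpsr R.
Hypothesis X0 : forall x, X x [::] = 0.

(** The continuous morphism with x |-> X x. *)
Definition nc_subst : ncpsr R -> ncpsr R :=
  sval (recursion_exists (fun a => a [::] *: (1 : ncpsr R)) X0).

Lemma nc_substE : solves_recursion (fun a => a [::] *: (1 : ncpsr R)) X nc_subst.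
Proof. exact: svalP. Qed.

Lemma nc_subst_linear : linear nc_subst.
Proof.
by apply: (recursion_linear X0 nc_substE) => c a b; rewrite scalerDl scalerA.
Qed.

Lemma nc_subst_continuous : nc_continuous nc_subst.
Proof.
by apply: (recursion_continuous X0 nc_substE) => a b N ab s sN; rewrite ab.
Qed.

Lemma nc_subst1 : nc_subst 1 = 1.
Proof.
rewrite nc_substE !nc_tail1 (linear_zero nc_subst_linear) !mulr0 !addr0.
exact: scale1r.
Qed.

Lemma nc_subst_letter x : nc_subst (letter_var x) = X x.
Proof.
rewrite nc_substE letter_var0 scale0r add0r !nc_tail_letter.
case: x => /=; rewrite (linear_zero nc_subst_linear) nc_subst1 mulr1 mulr0.
  by rewrite addr0.
by rewrite add0r.
Qed.

Lemma nc_substM a b : nc_subst (a * b) = nc_subst a * nc_subst b.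
Proof.
apply/eqP; rewrite -subr_eq0; apply/eqP.
pose D a := nc_subst (a * b) - nc_subst a * nc_subst b.
apply: (@nc_contraction _ D X nc_tail X0) => {}a; rewrite /D.
rewrite nc_substE (nc_substE a) nc_mul0E !nc_tailM.
rewrite !(linear_add nc_subst_linear) !(linear_scale nc_subst_linear).
rewrite 2!mulrDl nc_scale1l [in X in _ - (_ *: X + _ + _)](nc_substE b).
rewrite !scalerDr scalerA !mulrBr !mulrDr -!nc_scaleAr !mulrA; nc_abel.
Qed.

End Substitution.

Section Morphism.
Variable f : ncpsr R -> ncpsr R.
Hypotheses (f_lin : linear f) (f_mon : monoid_morphism f).

Lemma morphism_decomp a :
  f a = a [::] *: (1 : ncpsr R) + f vtau * f (nc_tail Ltau a)
        + f vt * f (nc_tail Lt a).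
Proof.
have [f1 fM] := f_mon.
by rewrite {1}[a]nc_decomp !(linear_add f_lin) (linear_scale f_lin) f1 !fM.
Qed.

(** Both sides solve the Horner recursion [ps_compE]. *)
Lemma morphism_ps_incl A F : F 0%N = 0 -> f vt = ps_incl F ->
  f (ps_incl A) = ps_incl (ps_comp A F).
Proof.
move=> F0 fvt; apply/eqP; rewrite -subr_eq0; apply/eqP.
pose D A := f (ps_incl A) - ps_incl (ps_comp A F).
apply: (@nc_contraction _ D (fun x => if x is Lt then ps_incl F else 0)
  (fun=> @ps_tail R)) => [[]//|{}A]; rewrite /D mul0r add0r.
have [f1 fM] := f_mon.
rewrite ps_incl_decomp (linear_add f_lin) (linear_scale f_lin) f1 fM fvt.
rewrite ps_compE // ps_inclD ps_inclZ ps_incl1 ps_inclM mulrBr; nc_abel.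
Qed.

End Morphism.

(** As f x = g x has no constant term for x = tau, t, the difference D = f - g
    solves the homogeneous recursion D a = sum of the f x * D (nc_tail x
    a). *)
Lemma morphism_ext (f g : ncpsr R -> ncpsr R) :
    linear f -> monoid_morphism f -> linear g -> monoid_morphism g ->
    f vtau = g vtau -> f vt = g vt -> f vtau [::] = 0 -> f vt [::] = 0 ->
  f =1 g.
Proof.
move=> fl fm gl gm ftau ft tau0 t0 a; apply/eqP; rewrite -subr_eq0; apply/eqP.
pose D a := f a - g a.
apply: (@nc_contraction _ D (fun x => f (letter_var x)) nc_tail) => [[]//|{}a].
rewrite /D (morphism_decomp fl fm) (morphism_decomp gl gm) -ftau -ft !mulrBr.
nc_abel.
Qed.

(** The grading involution: when R is evenly graded and tau, t are odd, it acts
    on series of degree n by (-1)^n, see [nc_sign_homog]. It turns the signed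
    Leibniz rule into one that makes sense for all series. *)
Definition nc_sign a : ncpsr R := fun s => (-1) ^+ size s * a s.

Lemma nc_sign_tail x a : nc_tail x (nc_sign a) = - nc_sign (nc_tail x a).
Proof.
apply/funext => s; rewrite /nc_tail nc_oppE /nc_sign /=.
by rewrite exprS mulN1r mulNr.
Qed.

Lemma nc_sign_decomp a : nc_sign a = a [::] *: (1 : ncpsr R)
  - vtau * nc_sign (nc_tail Ltau a) - vt * nc_sign (nc_tail Lt a).
Proof.
rewrite {1}[nc_sign a]nc_decomp !nc_sign_tail !mulrN.
by rewrite {1}/nc_sign /= expr0 mul1r.
Qed.

Lemma Nletter_var0 x : (- letter_var x) [::] = 0.
Proof. by rewrite nc_oppE letter_var0 oppr0. Qed.

Section Derivation.
Variable V : letter -> ncpsr R.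

Let base a := V Ltau * nc_tail Ltau a + V Lt * nc_tail Lt a.

(** The continuous odd derivation with x |-> V x. The recursion is the signed
    Leibniz rule applied to the terms x * nc_tail x a of a. *)
Definition nc_deriv : ncpsr R -> ncpsr R :=
  sval (@recursion_exists base (fun x => - letter_var x) Nletter_var0).

Lemma nc_deriv_rec : solves_recursion base (fun x => - letter_var x) nc_deriv.
Proof. exact: svalP. Qed.

Lemma nc_derivE a : nc_deriv a =
  V Ltau * nc_tail Ltau a + V Lt * nc_tail Lt a
  - vtau * nc_deriv (nc_tail Ltau a) - vt * nc_deriv (nc_tail Lt a).
Proof. by rewrite nc_deriv_rec !mulNr. Qed.

Lemma nc_deriv_linear : linear nc_deriv.
Proof.
apply: (@recursion_linear _ _ Nletter_var0 _ nc_deriv_rec) => c a b.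
by rewrite /base !nc_tailD !nc_tailZ !mulrDr -!nc_scaleAr; nc_abel.
Qed.

Lemma nc_deriv_continuous : nc_continuous nc_deriv.
Proof.
apply: (@recursion_continuous _ _ Nletter_var0 _ nc_deriv_rec) => a b N ab s sN.
rewrite /base !nc_addE !nc_mulE; congr (_ + _); apply: eq_bigr => i _;
  by congr (_ * _); apply: ab; rewrite /= size_drop; lia.
Qed.

(** The failure of the Leibniz rule, as a function of a, obeys the homogeneous
    recursion with coefficients - x. *)
Lemma nc_derivM a b : nc_deriv (a * b) = nc_deriv a * b + nc_sign a * nc_deriv b.
Proof.
apply/eqP; rewrite -subr_eq0; apply/eqP.
pose D a := nc_deriv (a * b) - (nc_deriv a * b + nc_sign a * nc_deriv b).
apply: (@nc_contraction _ D (fun x => - letter_var x) nc_tail Nletter_var0) => {}a.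
rewrite /D (nc_derivE (a * b)) (nc_derivE a) (nc_sign_decomp a) !nc_tailM.
rewrite !(linear_add nc_deriv_linear) !(linear_scale nc_deriv_linear).
rewrite !mulrBl !mulrDl nc_scale1l [in X in _ - (_ + (_ *: X - _ - _))](nc_derivE b).
rewrite !mulNr !mulrBr !mulrDr -!nc_scaleAr !mulrA; nc_abel.
Qed.

Lemma nc_deriv_letter x : nc_deriv (letter_var x) = V x.
Proof.
have D0 : nc_deriv 0 = 0 := linear_zero nc_deriv_linear.
have D1 : nc_deriv 1 = 0.
  by rewrite nc_derivE !nc_tail1 D0 !mulr0 !subr0 addr0.
rewrite nc_derivE !nc_tail_letter.
by case: x => /=; rewrite D0 D1 !mulr0 mulr1 !subr0 ?addr0 ?add0r.
Qed.

End Derivation.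

Lemma nc_derivD V W a :
  nc_deriv V a + nc_deriv W a = nc_deriv (fun x => V x + W x) a.
Proof.
apply/eqP; rewrite -subr_eq0; apply/eqP.
pose D a := nc_deriv V a + nc_deriv W a - nc_deriv (fun x => V x + W x) a.
apply: (@nc_contraction _ D (fun x => - letter_var x) nc_tail Nletter_var0) => {}a.
rewrite /D (nc_derivE V a) (nc_derivE W a) (nc_derivE (fun x => V x + W x) a).
rewrite !mulrDl !mulNr !mulrBr !mulrDr; nc_abel.
Qed.

Lemma nc_derivN V a : - nc_deriv V a = nc_deriv (fun x => - V x) a.
Proof.
apply/eqP; rewrite -subr_eq0; apply/eqP.
pose D a := - nc_deriv V a - nc_deriv (fun x => - V x) a.
apply: (@nc_contraction _ D (fun x => - letter_var x) nc_tail Nletter_var0) => {}a.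
rewrite /D (nc_derivE V a) (nc_derivE (fun x => - V x) a).
rewrite !mulNr !mulrBr !mulrN; nc_abel.
Qed.

(** The right-hand side is the graded commutator with tau, see [ad_tauE]; it is
    the odd derivation with tau |-> 2 tau^2 and t |-> tau t + t tau. *)
Lemma nc_deriv_ad a :
  nc_deriv (fun x => vtau * letter_var x + letter_var x * vtau) a
  = vtau * a - nc_sign a * vtau.
Proof.
set V := fun x => _; apply/eqP; rewrite -subr_eq0; apply/eqP.
pose D a := nc_deriv V a - (vtau * a - nc_sign a * vtau).
apply: (@nc_contraction _ D (fun x => - letter_var x) nc_tail Nletter_var0) => {}a.
have tau_a : vtau * a = a [::] *: vtau + vtau * (vtau * nc_tail Ltau a)
                        + vtau * (vt * nc_tail Lt a).
  by rewrite {1}[a]nc_decomp !mulrDr nc_scale1r.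
rewrite /D (nc_derivE V a) (nc_sign_decomp a) tau_a /V /=.
rewrite !mulrDl nc_scale1l !mulNr !mulrBr -!mulrA; nc_abel.
Qed.

End NoncommutativePowerSeries.

(** * Degrees and odd derivations *)

Section HomogeneousNoncommutativeSeries.
Variables (R : comPzRingType) (gr : grading R) (d : int).
Implicit Types (a b : ncpsr R) (A : psr R) (n k : int) (x : letter).
Local Notation nc_homog := (nc_homog gr d).
Local Notation wd := (word_deg d).

Lemma word_deg_cons x s : wd (x :: s) = letter_deg d x + wd s.
Proof. by rewrite /word_deg big_cons. Qed.

Lemma word_deg_nil : wd [::] = 0.
Proof. by rewrite /word_deg big_nil. Qed.

Lemma word_deg_take_drop i s : wd s = wd (take i s) + wd (drop i s).
Proof. by rewrite /word_deg -big_cat cat_take_drop. Qed.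

Lemma nc_homogD n a b : nc_homog n a -> nc_homog n b -> nc_homog n (a + b).
Proof. by move=> ha hb s; apply: homogD. Qed.

Lemma nc_homogN n a : nc_homog n a -> nc_homog n (- a).
Proof. by move=> ha s; apply: homogN. Qed.

Lemma nc_homog0 n : nc_homog n 0.
Proof. by move=> s; apply: homog0. Qed.

Lemma nc_homogM n k a b :
  nc_homog n a -> nc_homog k b -> nc_homog (n + k) (a * b).
Proof.
move=> ha hb s; rewrite nc_mulE; apply: homog_bigsum => i _.
by rewrite (word_deg_take_drop i s) opprD addrACA; apply: homogM.
Qed.

Lemma nc_homog_tail n x a :
  nc_homog n a -> nc_homog (n - letter_deg d x) (nc_tail x a).
Proof. by move=> ha s; rewrite -addrA -opprD -word_deg_cons; apply: ha. Qed.

Lemma nc_homog_letter x : nc_homog (letter_deg d x) (letter_var R x).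
Proof.
move=> [|y [|z s]]; first by rewrite letter_var0; exact: homog0.
  rewrite /word_deg big_seq1.
  by case: x y => [] [] /=; try exact: homog0; rewrite subrr; exact: homog1.
by case: x y => [] [] /=; exact: homog0.
Qed.

Lemma nc_homog_incl n A : ps_homog gr d n A -> nc_homog n (ps_incl A).
Proof.
move=> hA s; rewrite /ps_incl; case: ifP => [Ls|_]; last exact: homog0.
suff -> : wd s = - ((d + 2) *+ size s) by rewrite opprK; exact: hA.
elim: s Ls => [_|[] s IHs //= Ls]; first by rewrite word_deg_nil oppr0.
by rewrite word_deg_cons IHs // -opprD -mulrS.
Qed.

(** By induction on the length of the words, as in [recursion_exists]. *)
Lemma recursion_degree k base (Y : letter -> ncpsr R) g :
    (forall x, Y x [::] = 0) -> solves_recursion base Y g ->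
    (forall x, nc_homog (letter_deg d x) (Y x)) -> has_degree gr d k base ->
  has_degree gr d k g.
Proof.
move=> Y0 gE hY hbase.
suff hg N n a s : (size s < N)%N -> nc_homog n a -> gr (n + k - wd s) (g a s).
  by move=> n a ha s; exact: (hg (size s).+1).
elim: N n a s => // N IHN n a s sN ha.
have term x : gr (n + k - wd s) ((Y x * g (nc_tail x a)) s).
  rewrite nc_mulE big_ord_recl take0 Y0 mul0r add0r.
  apply: homog_bigsum => i _; rewrite (word_deg_take_drop (lift ord0 i) s).
  set p := take _ s; set q := drop _ s.
  have -> : n + k - (wd p + wd q)
      = (letter_deg d x - wd p) + (n - letter_deg d x + k - wd q) by ring.
  apply: homogM; first exact: hY.
  apply: IHN; last exact: nc_homog_tail.
  by rewrite size_drop lift0; have := ltn_ord i; lia.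
by rewrite gE !nc_addE; do ![apply: homogD => //]; apply: hbase.
Qed.

Hypothesis d_odd : oddz d.

Lemma letter_deg_odd x : odd `|letter_deg d x|%N.
Proof. by case: x => //=; move: d_odd; rewrite /oddz; lia. Qed.

Lemma word_deg_odd s : odd `|wd s|%N = odd (size s).
Proof.
elim: s => [|x s IHs]; first by rewrite word_deg_nil.
by rewrite word_deg_cons /= -IHs; have := letter_deg_odd x; lia.
Qed.

(** A word of length n has degree congruent to n modulo 2, and tau has degree
    -1, so the Koszul sign is (-1)^n. *)
Lemma ad_tauE a : ad d vtau a = vtau * a - nc_sign a * vtau.
Proof.
apply/funext => s; rewrite nc_addE nc_oppE !nc_mulE -sumrB.
apply: eq_bigr => i _; congr (_ - _); rewrite /nc_sign mulrA.
case E: (drop i s) => [|[] [|x p]]; rewrite ?mulr0 //; congr (_ * _ * _).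
rewrite /ksign -signr_odd abszM oddM word_deg_odd word_deg_cons word_deg_nil.
by rewrite andbT signr_odd.
Qed.

Hypothesis gr_even : evenly_graded gr.

(** The coefficient of a word s in a series of degree n has degree n - |s|; it
    is zero unless n and |s| have the same parity. *)
Lemma nc_sign_homog n a : nc_homog n a -> nc_sign a = ksign R n *: a.
Proof.
move=> ha; apply/funext => s; rewrite nc_scaleE /nc_sign /ksign.
have [od|ev] := boolP (oddz (n - wd s)).
  by rewrite (gr_even od (ha s)) !mulr0.
congr (_ * _); rewrite -signr_odd -word_deg_odd -[RHS]signr_odd.
by congr (_ ^+ nat_of_bool _); move: ev; rewrite /oddz; lia.
Qed.

Lemma cont_derivation_nc_deriv (V : letter -> ncpsr R) :
    (forall x, nc_homog (letter_deg d x - 1) (V x)) ->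
  cont_derivation gr d (-1) (nc_deriv V).
Proof.
move=> hV; split.
- exact: nc_deriv_linear.
- exact: nc_deriv_continuous.
- apply: (recursion_degree (@Nletter_var0 R) (nc_deriv_rec V)).
    by move=> x; apply: nc_homogN; exact: nc_homog_letter.
  move=> n a ha; have tl x : nc_homog (n - 1) (V x * nc_tail x a).
    have -> : n - 1 = (letter_deg d x - 1) + (n - letter_deg d x) by ring.
    by apply: nc_homogM => //; exact: nc_homog_tail.
  exact: nc_homogD.
- move=> n a b ha; rewrite nc_derivM (nc_sign_homog ha) -nc_scaleAl.
  by rewrite /ksign mulN1r abszN.
Qed.

End HomogeneousNoncommutativeSeries.

Section OddDerivations.
Variables (R : comPzRingType) (gr : grading R) (d : int).
Hypotheses (d_odd : oddz d).
Variable m : ncpsr R -> ncpsr R.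
Hypothesis m_der : cont_derivation gr d (-1) m.
Implicit Types (a b : ncpsr R) (A : psr R).

Lemma odd_derivationM n a b : oddz n -> nc_homog gr d n a ->
  m (a * b) = m a * b - a * m b.
Proof.
move=> on ha; have [_ _ _ mM] := m_der; rewrite (mM _ _ _ ha).
rewrite /oddz in on.
by rewrite /ksign mulN1r abszN -signr_odd on expr1 scaleN1r.
Qed.

Lemma odd_derivation1 : m 1 = 0.
Proof.
have [_ _ _ mM] := m_der; have h1 : nc_homog gr d 0 (1 : ncpsr R).
  by rewrite -ps_incl1; apply: nc_homog_incl; exact: ps_homog1.
have := mM 0 1 1 h1; rewrite mulr0 /ksign expr0 scale1r !mul1r mulr1 => E.
by apply: (@addrI _ (m 1)); rewrite -E addr0.
Qed.

Lemma odd_derivation_letter x b :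
  m (letter_var R x * b) = m (letter_var R x) * b - letter_var R x * m b.
Proof.
apply: (@odd_derivationM (letter_deg d x)); first exact: letter_deg_odd.
exact: nc_homog_letter.
Qed.

(** Thus an odd derivation is determined by its values on tau and t. *)
Lemma odd_derivation_decomp a : m a =
  m vtau * nc_tail Ltau a - vtau * m (nc_tail Ltau a)
  + (m vt * nc_tail Lt a - vt * m (nc_tail Lt a)).
Proof.
have [m_lin _ _ _] := m_der.
rewrite {1}[a]nc_decomp !(linear_add m_lin) (linear_scale m_lin) odd_derivation1.
rewrite scaler0 add0r.
by rewrite (odd_derivation_letter Ltau) (odd_derivation_letter Lt).
Qed.

(** The value on A of the graded derivation d/dt for an odd variable t. *)
Definition odd_t_derivative A : psr R := fun n => if odd n then 0 else A n.+1.

Lemma odd_t_derivative_tail A :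
  odd_t_derivative A = ps_tail A - ps_var R * odd_t_derivative (ps_tail A).
Proof.
apply/funext => n; rewrite ps_addE ps_oppE ps_mulVE /odd_t_derivative /ps_tail.
by case: n => [|n] /=; [rewrite subr0|case: odd; rewrite /= ?subrr ?subr0].
Qed.

(** On R[[t]], the derivation m is the sum of v d/dt and the graded commutator
    with tau, because this sum obeys the recursion of
    [odd_derivation_decomp]. *)
Lemma odd_derivation_incl v A : m vt = ps_incl v + (vtau * vt + vt * vtau) ->
  m (ps_incl A) = ps_incl (v * odd_t_derivative A)
                  + (vtau * ps_incl A - nc_sign (ps_incl A) * vtau).
Proof.
move=> mt; apply/eqP; rewrite -subr_eq0; apply/eqP.
pose D A := m (ps_incl A) - (ps_incl (v * odd_t_derivative A)
  + (vtau * ps_incl A - nc_sign (ps_incl A) * vtau)).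
apply: (@nc_contraction _ _ D (fun x => if x is Lt then - vt else 0)
  (fun=> @ps_tail R)) => [[]//|{}A].
  by rewrite nc_oppE oppr0.
rewrite /D mul0r add0r odd_derivation_decomp ps_incl_tau ps_incl_tail mt.
have [m_lin _ _ _] := m_der; rewrite (linear_zero m_lin) !mulr0 subr0 add0r.
have tau_A : vtau * ps_incl A
    = A 0%N *: vtau + vtau * vt * ps_incl (ps_tail A).
  by rewrite ps_incl_decomp mulrDr nc_scale1r mulrA.
have A_tau : nc_sign (ps_incl A) * vtau
    = A 0%N *: vtau - vt * nc_sign (ps_incl (ps_tail A)) * vtau.
  have sign0 : nc_sign (0 : ncpsr R) = 0.
    by apply/funext => s; rewrite /nc_sign mulr0.
  rewrite nc_sign_decomp ps_incl_tau ps_incl_tail sign0 mulr0 subr0 mulrBl.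
  by rewrite nc_scale1l.
rewrite tau_A A_tau odd_t_derivative_tail mulrBr mulrCA ps_inclD ps_inclN.
rewrite !ps_inclM ps_incl_var !mulNr !mulrBr !mulrDl !mulrDr !mulrN !mulrA.
nc_abel.
Qed.

End OddDerivations.

(** * Odd Moore algebras and their isomorphisms *)

Section MooreAlgebras.
Variables (R : comPzRingType) (gr : grading R) (d : int).
Hypotheses (d_odd : oddz d) (gr_even : evenly_graded gr).
Implicit Types (m f : ncpsr R -> ncpsr R) (A F G u v w : psr R).

Lemma ps_homog_odd n A : oddz n -> ps_homog gr d n A ->
  forall i, ~~ odd i -> A i = 0.
Proof.
move=> on hA i ei; apply: gr_even (hA i).
by move: d_odd on ei; rewrite /oddz -mulr_natr; lia.
Qed.

Lemma ps_homog_even n A : ~~ oddz n -> ps_homog gr d n A ->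
  forall i, odd i -> A i = 0.
Proof.
move=> en hA i oi; apply: gr_even (hA i).
by move: d_odd en oi; rewrite /oddz -mulr_natr; lia.
Qed.

Lemma odd_t_derivative_odd n A : oddz n -> ps_homog gr d n A ->
  odd_t_derivative A = ps_tail A.
Proof.
move=> on hA; apply/funext => i; rewrite /odd_t_derivative /ps_tail.
by case: ifP => // oi; rewrite (ps_homog_odd on hA) //= oi.
Qed.

Lemma nc_sign_incl_odd n A : oddz n -> ps_homog gr d n A ->
  nc_sign (ps_incl A) = - ps_incl A.
Proof.
move=> on hA; rewrite (nc_sign_homog d_odd gr_even (nc_homog_incl hA)).
by rewrite /oddz in on; rewrite /ksign -signr_odd on expr1 scaleN1r.
Qed.

Lemma nc_sign_tau : nc_sign (vtau : ncpsr R) = - vtau.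
Proof.
rewrite (nc_sign_homog d_odd gr_even (nc_homog_letter gr d Ltau)).
by rewrite /ksign expr1 scaleN1r.
Qed.

Lemma nc_sign_t : nc_sign (vt : ncpsr R) = - vt.
Proof.
rewrite (nc_sign_homog d_odd gr_even (nc_homog_letter gr d Lt)) /ksign -signr_odd.
by rewrite (letter_deg_odd d_odd Lt) expr1 scaleN1r.
Qed.

(** The values on tau and t of the Moore algebra given by v and w. The graded
    commutator of tau with itself is 2 tau^2, of which tau^2 is subtracted. *)
Definition moore_letter v w (x : letter) : ncpsr R :=
  if x is Ltau then ps_incl w + vtau ^+ 2
  else ps_incl v + (vtau * vt + vt * vtau).

Lemma odd_Moore_algebra_letters m : odd_Moore_algebra gr d m ->
  exists v w, [/\ even_series v /\ ps_homog gr d (- (d + 3)) v,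
    even_series w /\ ps_homog gr d (-2) w,
    m vtau = ps_incl w + vtau ^+ 2 & m vt = ps_incl v + (vtau * vt + vt * vtau)].
Proof.
move=> [_ [v [w [Dv [Dw [Dtau [hv hw [[_ Dv1 Dv2] [_ Dw1 Dw2] [_ Dt1 Dt2]] mE]]]]]]].
exists v, w; split => //; rewrite mE ad_tauE //.
  by rewrite Dv1 Dw1 Dt1 nc_sign_tau expr2 mulNr; nc_abel.
by rewrite Dv2 Dw2 Dt2 nc_sign_t mulNr; nc_abel.
Qed.

Lemma odd_Moore_algebra_deriv v w :
    even_series v -> ps_homog gr d (- (d + 3)) v ->
    even_series w -> ps_homog gr d (-2) w ->
  odd_Moore_algebra gr d (nc_deriv (moore_letter v w)).
Proof.
move=> ev hv ew hw; pose ht := nc_homog_letter (R := R) gr d Lt.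
pose htau := nc_homog_letter (R := R) gr d Ltau.
have hv' : nc_homog gr d (- (d + 2) - 1) (ps_incl v).
  have -> : - (d + 2) - 1 = - (d + 3) by ring.
  exact: nc_homog_incl.
have hw' : nc_homog gr d (-1 - 1) (ps_incl w) by exact: nc_homog_incl.
have htau2 : nc_homog gr d (-1 - 1) (vtau ^+ 2 : ncpsr R).
  by rewrite expr2; apply: nc_homogM.
have htt : nc_homog gr d (- (d + 2) - 1) (vtau * vt + vt * vtau : ncpsr R).
  by apply: nc_homogD; [rewrite addrC|]; apply: nc_homogM.
have z n : nc_homog gr d n (0 : ncpsr R) by exact: nc_homog0.
have der V : (forall x, nc_homog gr d (letter_deg d x - 1) (V x)) ->
    is_derivation_by gr d (-1) (V Ltau) (V Lt) (nc_deriv V).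
  move=> hV; split; first exact: cont_derivation_nc_deriv.
    exact: (nc_deriv_letter V Ltau).
  exact: (nc_deriv_letter V Lt).
split; first by apply: cont_derivation_nc_deriv => // -[]; apply: nc_homogD.
exists v, w, (nc_deriv (fun x => if x is Lt then ps_incl v else 0)).
exists (nc_deriv (fun x => if x is Ltau then ps_incl w else 0)).
exists (nc_deriv (fun x => if x is Ltau then vtau ^+ 2 else 0)); split => //.
  split; first by apply: (der (fun x => if x is Lt then ps_incl v else 0)) => -[].
    by apply: (der (fun x => if x is Ltau then ps_incl w else 0)) => -[].
  by apply: (der (fun x => if x is Ltau then vtau ^+ 2 else 0)) => -[].
move=> a; rewrite ad_tauE // -nc_deriv_ad !nc_derivN !nc_derivD.
congr (nc_deriv _ a); apply/funext => -[] /=; last by rewrite !addr0 oppr0 addr0.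
by rewrite expr2; nc_abel.
Qed.

Section Intertwining.
Variables (m m' f : ncpsr R -> ncpsr R) (v w v' w' F G : psr R).
Hypotheses (m_der : cont_derivation gr d (-1) m)
  (m'_der : cont_derivation gr d (-1) m').
Hypotheses (m_tau : m vtau = ps_incl w + vtau ^+ 2)
  (m_t : m vt = ps_incl v + (vtau * vt + vt * vtau)).
Hypotheses (m'_tau : m' vtau = ps_incl w' + vtau ^+ 2)
  (m'_t : m' vt = ps_incl v' + (vtau * vt + vt * vtau)).
Hypotheses (f_lin : linear f) (f_mon : monoid_morphism f).
Hypotheses (f_tau : f vtau = vtau + ps_incl G) (f_t : f vt = ps_incl F).
Hypotheses (F0 : F 0%N = 0) (G0 : G 0%N = 0).
Hypotheses (F_homog : ps_homog gr d (- (d + 2)) F) (G_homog : ps_homog gr d (-1) G).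

Let odd_t : oddz (- (d + 2)). Proof. by move: d_odd; rewrite /oddz; lia. Qed.
Let odd_tau : oddz (-1). Proof. by []. Qed.

(** The difference D of m f and f m' satisfies D(x a) = - f(x) D(a) as soon as
    it vanishes on the letter x, because f(x) is homogeneous of odd degree. *)
Lemma intertwining_letters :
  m \o f = f \o m' <-> m (f vtau) = f (m' vtau) /\ m (f vt) = f (m' vt).
Proof.
split=> [/(congr1 (fun D : ncpsr R -> ncpsr R => (D vtau, D vt))) [] //|].
move=> [mf_tau mf_t].
have [[m_lin _ _ _] [m'_lin _ _ _]] := (m_der, m'_der).
apply/funext => a /=; apply/eqP; rewrite -subr_eq0; apply/eqP.
pose D a := m (f a) - f (m' a).
apply: (@nc_contraction _ _ D (fun x => - f (letter_var R x)) (@nc_tail R))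
  => [x|{}a].
  rewrite nc_oppE; case: x => /=; rewrite ?f_tau ?f_t ?nc_addE /ps_incl /=.
    by rewrite G0 addr0 oppr0.
  by rewrite F0 oppr0.
have [f1 fM] := f_mon.
rewrite /D (odd_derivation_decomp d_odd m'_der a) {1}[a]nc_decomp.
have fl := linear_add f_lin; have fN := linear_scale f_lin (-1).
rewrite !fl !(linear_add m_lin) (linear_scale f_lin) f1.
rewrite (linear_scale m_lin) (odd_derivation1 m_der) scaler0 add0r.
rewrite -!scaleN1r !fN !scaleN1r !fM -mf_tau -mf_t.
rewrite (@odd_derivationM _ _ _ _ m_der _ (f vtau) _ odd_tau); last first.
  rewrite f_tau; apply: nc_homogD; last exact: nc_homog_incl.
  exact: (nc_homog_letter gr d Ltau).
rewrite (@odd_derivationM _ _ _ _ m_der _ (f vt) _ odd_t); last first.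
  by rewrite f_t; exact: nc_homog_incl.
by rewrite /= !mulNr !mulrBr; nc_abel.
Qed.

(** The terms that contain tau are the same on both sides on account of the
    signs of the odd series F and G; what remains lives in R[[t]], where t
    commutes with itself. *)
Lemma intertwining_series : m \o f = f \o m' <->
  v * ps_tail F = ps_comp v' F + 2%:R *: (G * F)
  /\ w + v * ps_tail G = ps_comp w' F + G * G.
Proof.
have [m_lin _ _ _] := m_der; have [f1 fM] := f_mon.
have fl := linear_add f_lin.
rewrite intertwining_letters f_tau f_t m'_tau m'_t !fl expr2 !fM f_tau f_t.
rewrite !(morphism_ps_incl f_lin f_mon _ F0 f_t) (linear_add m_lin) m_tau expr2.
rewrite !(odd_derivation_incl d_odd m_der _ m_t).
rewrite (odd_t_derivative_odd odd_tau G_homog) (odd_t_derivative_odd odd_t F_homog).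
rewrite (nc_sign_incl_odd odd_tau G_homog) (nc_sign_incl_odd odd_t F_homog).
rewrite !mulNr !opprK.
pose g := ps_incl G; pose e := ps_incl F.
have -> : ps_incl w + vtau * vtau + (ps_incl (v * ps_tail G) + (vtau * g + g * vtau))
    = ps_incl (w + v * ps_tail G) + (vtau * vtau + vtau * g + g * vtau).
  by rewrite ps_inclD; nc_abel.
have -> : ps_incl (ps_comp w' F) + (vtau + g) * (vtau + g)
    = ps_incl (ps_comp w' F + G * G) + (vtau * vtau + vtau * g + g * vtau).
  by rewrite ps_inclD ps_inclM !mulrDl !mulrDr; nc_abel.
have -> : ps_incl (ps_comp v' F) + ((vtau + g) * e + e * (vtau + g))
    = ps_incl (ps_comp v' F + 2%:R *: (G * F)) + (vtau * e + e * vtau).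
  rewrite ps_inclD ps_inclZ ps_inclM !mulrDl !mulrDr.
  rewrite -[e * g]ps_inclM [F * G]mulrC ps_inclM -/g -/e.
  by rewrite scaler_nat mulr2n; nc_abel.
by split=> [[/addIr/ps_incl_inj -> /addIr/ps_incl_inj ->]|[-> ->]].
Qed.

End Intertwining.
End MooreAlgebras.

(** * The invariant and the classification *)

Section ChangeOfVariables.
Variables (R : comPzRingType) (gr : grading R) (d : int).
Implicit Types (F G L : psr R) (f : ncpsr R -> ncpsr R).

Definition change_letter F G (x : letter) : ncpsr R :=
  if x is Ltau then vtau + ps_incl G else ps_incl F.

Lemma change_letter0 F G : F 0%N = 0 -> G 0%N = 0 ->
  forall x, change_letter F G x [::] = 0.
Proof. by move=> F0 G0 [] //=; rewrite nc_addE /ps_incl /= G0 addr0. Qed.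

Definition change_map F G (F0 : F 0%N = 0) (G0 : G 0%N = 0) :=
  nc_subst (change_letter0 F0 G0).

Section Values.
Variables (F G : psr R) (F0 : F 0%N = 0) (G0 : G 0%N = 0).

Lemma change_map_tau : change_map F0 G0 vtau = vtau + ps_incl G.
Proof. exact: (nc_subst_letter (change_letter0 F0 G0) Ltau). Qed.

Lemma change_map_t : change_map F0 G0 vt = ps_incl F.
Proof. exact: (nc_subst_letter (change_letter0 F0 G0) Lt). Qed.

Lemma change_map_linear : linear (change_map F0 G0).
Proof. exact: nc_subst_linear. Qed.

Lemma change_map_monoid : monoid_morphism (change_map F0 G0).
Proof. by split; [exact: nc_subst1|move=> a b; exact: nc_substM]. Qed.

Lemma change_map_incl A :
  change_map F0 G0 (ps_incl A) = ps_incl (ps_comp A F).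
Proof.
exact: (morphism_ps_incl change_map_linear change_map_monoid A F0 change_map_t).
Qed.

End Values.

(** The inverse of tau |-> tau + G, t |-> F is tau |-> tau - G(L), t |-> L with
    L the inverse of F. Both composites fix tau and t. *)
Lemma change_mapK F G L (F0 : F 0%N = 0) (G0 : G 0%N = 0) (L0 : L 0%N = 0)
    (K0 : (- ps_comp G L) 0%N = 0) :
  ps_comp L F = ps_var R -> ps_comp F L = ps_var R ->
  cancel (change_map F0 G0) (change_map L0 K0) /\
  cancel (change_map L0 K0) (change_map F0 G0).
Proof.
move=> LF FL; pose f := change_map F0 G0; pose g := change_map L0 K0.
have comp_id (h k : ncpsr R -> ncpsr R) : linear h -> monoid_morphism h ->
    linear k -> monoid_morphism k -> k (h vtau) = vtau -> k (h vt) = vt ->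
    cancel h k.
  move=> hl [h1 hM] kl [k1 kM] khtau kht a.
  apply: (@morphism_ext _ (k \o h) id) => //=.
    by move=> c x y; rewrite /= hl kl.
  by split=> [|x y] /=; rewrite ?h1 ?hM.
  by rewrite khtau.
  by rewrite kht.
have fl := change_map_linear F0 G0; have fm := change_map_monoid F0 G0.
have gl := change_map_linear L0 K0; have gm := change_map_monoid L0 K0.
split; apply: comp_id => //.
- rewrite change_map_tau (linear_add gl) change_map_tau change_map_incl ps_inclN.
  by rewrite addrNK.
- by rewrite change_map_t change_map_incl FL ps_incl_var.
- rewrite change_map_tau (linear_add fl) change_map_tau change_map_incl.
  by rewrite ps_compN ps_compA // LF ps_comp_id ps_inclN addrK.
- by rewrite change_map_t change_map_incl LF ps_incl_var.
Qed.

Lemma change_of_variables F G : changes_variable gr d F -> G 0%N = 0 ->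
    ps_homog gr d (-1) G ->
  exists f, [/\ cont_automorphism f, has_degree gr d 0 f,
                f vtau = vtau + ps_incl G & f vt = ps_incl F].
Proof.
move=> FH G0 hG; have [L [L0 _ _] [LF FL]] := changes_variable_inv FH.
have [F0 hF _] := FH.
have K0 : (- ps_comp G L) 0%N = 0 by rewrite ps_oppE ps_comp0E G0 oppr0.
have [fK gK] := change_mapK F0 G0 L0 K0 LF FL.
exists (change_map F0 G0); split; [split| | |].
- exact: change_map_linear.
- exact: change_map_monoid.
- by exists (change_map L0 K0).
- exact: nc_subst_continuous.
- apply: (recursion_degree (change_letter0 F0 G0) (nc_substE _)) => [[]|n a ha s].
  + apply: nc_homogD; first exact: (nc_homog_letter gr d Ltau).
    exact: nc_homog_incl.
  + exact: nc_homog_incl.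
  case: s => [|x s]; rewrite nc_scaleE.
    by rewrite mulr1 addr0; exact: ha.
  by rewrite mulr0; exact: homog0.
- exact: change_map_tau.
- exact: change_map_t.
Qed.

End ChangeOfVariables.

Section Invariant.
Variables (R : comPzRingType) (gr : grading R) (d : int) (h : R).
Hypotheses (d_odd : oddz d) (gr_even : evenly_graded gr) (h2 : 2%:R * h = 1).
Implicit Types (m f : ncpsr R -> ncpsr R) (A F G u v w : psr R).

(** The terms without tau, a retraction of [ps_incl]. *)
Definition t_part (a : ncpsr R) : psr R := fun n => a (nseq n Lt).

Lemma t_partD a b : t_part (a + b) = t_part a + t_part b.
Proof. by []. Qed.

Lemma t_part_incl A : t_part (ps_incl A) = A.
Proof. by apply/funext => n; rewrite /t_part /ps_incl all_nseq orbT size_nseq. Qed.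

Lemma vtau_nseq n : vtau (nseq n Lt) = 0 :> R.
Proof. by case: n => [|[|n]]. Qed.

Lemma t_part_tauM a : t_part (vtau * a) = 0.
Proof.
apply/funext => n; rewrite /t_part nc_mulE big1 // => i _.
have i_n : (i <= n)%N by have := ltn_ord i; rewrite [X in (_ < X.+1)%N]size_nseq.
by rewrite take_nseq // vtau_nseq mul0r.
Qed.

Lemma t_partM_tau a : t_part (a * vtau) = 0.
Proof.
apply/funext => n; rewrite /t_part nc_mulE big1 // => i _.
by rewrite drop_nseq vtau_nseq mulr0.
Qed.

(** The series w + (v/2t)^2 for h = 1/2, written in terms of m alone by
    extracting w and v from the values of m on tau and t. *)
Definition invariant m : psr R :=
  t_part (m vtau) + (h *: ps_tail (t_part (m vt))) ^+ 2.

Lemma invariantE m v w : m vtau = ps_incl w + vtau ^+ 2 ->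
    m vt = ps_incl v + (vtau * vt + vt * vtau) ->
  invariant m = w + (h *: ps_tail v) ^+ 2.
Proof.
move=> m_tau m_t; rewrite /invariant m_tau m_t expr2 !t_partD !t_part_incl.
by rewrite !t_part_tauM !t_partM_tau !addr0.
Qed.

Lemma homog_half : gr 0 h.
Proof.
by apply: homog_inv h2; rewrite mulr2n; apply: homogD; exact: homog1.
Qed.

Lemma half_odd_homog v : even_series v -> ps_homog gr d (- (d + 3)) v ->
  (h *: ps_tail v) 0%N = 0 /\ ps_homog gr d (-1) (h *: ps_tail v).
Proof.
move=> [_ ev] hv; split; first by rewrite ps_scaleE /ps_tail ev ?mulr0.
apply: ps_homogZ; first exact: homog_half.
have -> : -1 = - (d + 3) + (d + 2) by ring.
exact: ps_homog_tail.
Qed.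

Lemma invariant_in_S m : odd_Moore_algebra gr d m -> Sset gr d (invariant m).
Proof.
move=> /(odd_Moore_algebra_letters d_odd gr_even)[v [w [[ev hv] [ew hw] m_tau m_t]]].
rewrite (invariantE m_tau m_t).
have [V0 hV] := half_odd_homog ev hv; split.
  by rewrite ps_addE expr2 ps_mul0E V0 mul0r addr0; case: ew.
by apply: ps_homogD => //; rewrite expr2; exact: (ps_homogM hV hV).
Qed.

(** Series in S are even, as R is evenly graded, so v = 0 and w = u is a Moore
    algebra. *)
Lemma invariant_surjective u : Sset gr d u ->
  exists2 m, odd_Moore_algebra gr d m & invariant m = u.
Proof.
move=> [u0 hu]; have e0 : even_series (0 : psr R) by [].
have eu : even_series u by split => // i; apply: (ps_homog_even d_odd gr_even _ hu).
have h0 : ps_homog gr d (- (d + 3)) (0 : psr R) by move=> i; exact: homog0.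
exists (nc_deriv (moore_letter 0 u)).
  exact: odd_Moore_algebra_deriv.
rewrite (@invariantE _ 0 u).
- have -> : ps_tail (0 : psr R) = 0 by [].
  by rewrite scaler0 expr0n addr0.
- exact: (nc_deriv_letter _ Ltau).
- exact: (nc_deriv_letter _ Lt).
Qed.

(** Writing V = v/t and V' = (v'/t)(F), the first equation divided by F is V/2
    = V'/2 + G, so that (V/2)^2 = (V'/2)^2 + V G - G^2. *)
Lemma completing_square v w v' w' F G :
    changes_variable gr d F -> G 0%N = 0 -> v 0%N = 0 -> v' 0%N = 0 ->
  (v * ps_tail F = ps_comp v' F + 2%:R *: (G * F)
    /\ w + v * ps_tail G = ps_comp w' F + G * G) <->
  (G = h *: ps_tail v - h *: ps_comp (ps_tail v') F
    /\ w + (h *: ps_tail v) ^+ 2 = ps_comp (w' + (h *: ps_tail v') ^+ 2) F).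
Proof.
move=> FH G0 v0 v'0; have [F0 _ _] := FH.
have [U _ UF] := changes_variable_tail_inv FH.
pose H := ps_const h; pose V := ps_tail v; pose V' := ps_comp (ps_tail v') F.
have H2 : 2%:R * H = 1.
  have -> : 2%:R = ps_const (2%:R : R).
    by rewrite /ps_const scaler_nat.
  by rewrite -ps_constM h2 /ps_const scale1r.
(* F is regular because it divides the regular element t. *)
have t_reg : injective ( *%R F).
  move=> A B AB; apply: (@ps_mulV_inj R).
  have FU : F * U = ps_var R by rewrite [F](ps_decomp0 F0) mulrAC -mulrA UF mulr1.
  by rewrite -FU (mulrAC F U A) (mulrAC F U B) AB.
have vE : v = ps_var R * V := ps_decomp0 v0.
have FE : F = ps_var R * ps_tail F := ps_decomp0 F0.
have eq1 : v * ps_tail F = ps_comp v' F + 2%:R *: (G * F) <-> V = V' + 2%:R * G.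
  have -> : v * ps_tail F = F * V by rewrite vE [in RHS]FE; ring.
  have -> : ps_comp v' F + 2%:R *: (G * F) = F * (V' + 2%:R * G).
    rewrite [v'](ps_decomp0 v'0) ps_compM // ps_compX // -/V' scaler_nat; ring.
  by split=> [/t_reg|->].
have eq1' : V = V' + 2%:R * G <-> G = H * V - H * V'.
  split=> [->|->]; last first.
    by transitivity (V' + 2%:R * H * (V - V')); [rewrite H2; ring|ring].
  by transitivity (2%:R * H * G); [rewrite H2 mul1r|ring].
have vG : v * ps_tail G = V * G by rewrite vE {2}[G](ps_decomp0 G0); ring.
rewrite eq1 vG !expr2 ps_compD ps_compM // !ps_compZ !ps_scale_const -/H -/V -/V'.
have eq2 : V = V' + 2%:R * G ->
    (w + V * G = ps_comp w' F + G * G) <->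
    (w + H * V * (H * V) = ps_comp w' F + H * V' * (H * V')).
  move=> VE; have HV : H * V = H * V' + G.
    by rewrite VE; transitivity (H * V' + 2%:R * H * G); [ring|rewrite H2; ring].
  have -> : H * V * (H * V) = H * V' * (H * V') + V * G - G * G.
    rewrite HV VE.
    by transitivity (H * V' * (H * V') + 2%:R * H * V' * G + G * G);
      [ring|rewrite H2; ring].
  split=> E; last first.
    apply: (@addrI _ (H * V' * (H * V') - G * G)).
    transitivity (w + (H * V' * (H * V') + V * G - G * G)); first by ring.
    by rewrite E; ring.
  transitivity (w + V * G + (H * V' * (H * V') - G * G)); first by ring.
  by rewrite E; ring.
split=> -[E1 E2]; split.
- exact/eq1'.
- exact: (eq2 E1).1.
- exact/eq1'.
- by apply/eq2 => //; exact/eq1'.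
Qed.

(** Given F with u = u'(F), the series G is forced by [completing_square]; its
    degree is -1 and its constant term is zero since v and v' start at t^2. *)
Lemma weakly_equivalentP m m' :
    odd_Moore_algebra gr d m -> odd_Moore_algebra gr d m' ->
  weakly_equivalent gr d m m' <->
  exists2 F, changes_variable gr d F & invariant m = ps_comp (invariant m') F.
Proof.
move=> mM m'M; have [[m_der _] [m'_der _]] := (mM, m'M).
have [v [w [[ev hv] [ew hw] m_tau m_t]]] :=
  odd_Moore_algebra_letters d_odd gr_even mM.
have [v' [w' [[ev' hv'] [ew' hw'] m'_tau m'_t]]] :=
  odd_Moore_algebra_letters d_odd gr_even m'M.
rewrite (invariantE m_tau m_t) (invariantE m'_tau m'_t).
have [v0 _] := ev; have [v'0 _] := ev'.
have key f F G := @intertwining_series R gr d d_odd gr_even m m' f v w v' w' F G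
  m_der m'_der m_tau m_t m'_tau m'_t.
split=> [[f [[fl fm _ _] _ [F [G [G0 hG FH f_tau f_t]]]]]|[F FH uE]].
  have [F0 hF _] := FH.
  move/(key f F G fl fm f_tau f_t F0 G0 hF hG).
  move/(completing_square _ _ FH G0 v0 v'0) => [_ E].
  by exists F.
have [F0 hF _] := FH.
have [V0 hV] := half_odd_homog ev hv; have [V'0 hV'] := half_odd_homog ev' hv'.
pose G := h *: ps_tail v - h *: ps_comp (ps_tail v') F.
have G0 : G 0%N = 0.
  by rewrite /G ps_addE ps_oppE V0 -ps_compZ ps_comp0E V'0 subrr.
have hG : ps_homog gr d (-1) G.
  apply: ps_homogD => //; apply: ps_homogN; rewrite -ps_compZ.
  exact: ps_homog_comp.
have [f [f_aut f_deg f_tau f_t]] := change_of_variables FH G0 hG.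
have [fl fm _ _] := f_aut.
exists f; split => //; first by exists F, G.
apply/(key f F G fl fm f_tau f_t F0 G0 hF hG).
exact/(completing_square _ _ FH G0 v0 v'0).
Qed.

(** Equivalence to m is u = u'(F), while membership in the orbit of u is u' =
    u(L); the two agree by inverting F. *)
Lemma weak_equivalence_classE m : odd_Moore_algebra gr d m ->
  weak_equivalence_class gr d m =
  [set m' | odd_Moore_algebra gr d m' /\
            H_orbit gr d (invariant m) (invariant m')]%classic.
Proof.
move=> mM; apply/seteqP.
split=> m' /= [m'M]; [move=> E|move=> [F FH FE]]; split=> //.
  have [F FH ->] := (weakly_equivalentP mM m'M).1 E.
  have [F0 _ _] := FH; have [L LH [LF FL]] := changes_variable_inv FH.
  have [L0 _ _] := LH.
  by exists L => //; rewrite ps_compA // FL ps_comp_id.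
apply/(weakly_equivalentP mM m'M).
have [F0 _ _] := FH; have [L LH [LF FL]] := changes_variable_inv FH.
have [L0 _ _] := LH.
by exists L => //; rewrite -FE ps_compA // FL ps_comp_id.
Qed.

Lemma Sset_comp u F :
  Sset gr d u -> changes_variable gr d F -> Sset gr d (ps_comp u F).
Proof.
move=> [u0 hu] [F0 hF _]; split; first by rewrite ps_comp0E.
exact: ps_homog_comp.
Qed.

(** The whole orbit is reached because S is stable under H and each of its
    elements is an invariant. *)
Lemma invariant_class m : odd_Moore_algebra gr d m ->
  (invariant @` weak_equivalence_class gr d m = H_orbit gr d (invariant m))%classic.
Proof.
move=> mM; rewrite weak_equivalence_classE //; apply/seteqP; split=> u.
  by move=> [m' [_ m'u] <-].
move=> uO; have [F FH uE] := uO.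
have [m' m'M m'u] : exists2 m', odd_Moore_algebra gr d m' & invariant m' = u.
  apply: invariant_surjective; rewrite -uE; apply: Sset_comp => //.
  exact: invariant_in_S.
by exists m' => //; split => //; rewrite m'u.
Qed.

End Invariant.

Theorem theorem3p1 (R : comPzRingType) (gr : grading R) (d : int)
    (d_odd : oddz d) (gr_even : evenly_graded gr)
    (two_invertible : invertible (2%:R : R)) :
  exists phi : set (ncpsr R -> ncpsr R) -> set (psr R),
    set_bij (weak_equivalence_classes gr d) (H_orbits gr d) phi.
Proof.
have [h [h2 _]] := two_invertible.
have orbit := invariant_class d_odd gr_even h2.
exists (fun C => invariant h @` C)%classic; split.
- move=> _ [m mM <-]; rewrite orbit //.
  by exists (invariant h m) => //; exact: invariant_in_S.
- move=> _ _ /set_mem[m mM <-] /set_mem[m' m'M <-].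
  by rewrite !orbit // !(weak_equivalence_classE d_odd gr_even h2) // => ->.
- move=> _ [u uS <-]; have [m mM mu] := invariant_surjective h d_odd gr_even uS.
  exists (weak_equivalence_class gr d m); first by exists m.
  by rewrite orbit // mu.
Qed.
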